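(* Let $G$ be a finitely presented group and $H$ a finitely generated group, with respective filtrations $(N_i)_{i\in\mathbb{N}}$ and $(M_i)_{i\in\mathbb{N}}$, such that the box spaces $\Box_{(N_i)}G$ and $\Box_{(M_i)}H$ are coarsely equivalent. Then there exists an almost permutation $f$ of $\mathbb{N}$ with bounded displacement such that $N_i$ is isomorphic to $M_{f(i)}$ for every $i$ in the domain of $f$.
   Context: Filtration: for a residually finite, finitely generated group $G$, a filtration of $G$ is a sequence $(N_i)$ of nested ($N_{i+1}\subseteq N_i$), normal, finite index subgroups of $G$ with $\bigcap_i N_i=\{e\}$. Box space: fix a finite generating set $S$ of $G$. The box space $\Box_{(N_i)}G$ is the disjoint union $\bigsqcup_i G/N_i$, where each component $G/N_i$ carries the Cayley graph metric with respect to the image of $S$, and the distance between any two distinct components (i.e. between points of them) is the sum of their diameters. Changing the finite generating set gives a coarsely equivalent space. Coarse equivalence: a map $\varphi:X\to Y$ between metric spaces is a coarse embedding if there are proper functions $\rho_\pm:\mathbb{R}_+\to\mathbb{R}_+$ with $\rho_-(d_X(a,b))\le d_Y(\varphi(a),\varphi(b))\le\rho_+(d_X(a,b))$ for all $a,b\in X$. It is a coarse equivalence if moreover there is $C>0$ such that every $y\in Y$ is at distance at most $C$ from $\varphi(X)$. $X$ and $Y$ are coarsely equivalent if a coarse equivalence $X\to Y$ exists. Almost permutation: an almost permutation $f$ of $\mathbb{N}$ is a bijection between two cofinite subsets of $\mathbb{N}$. It has bounded displacement if there exist $A$ and $N$ such that $|f(n)-n|\le A$ for all $n\ge N$ (in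 the domain of $f$).
   Formalization: The filtration (N_i) of G is assumed to be without repetitions: N_{i+1} = N_i only if N_i is trivial. If nontrivial terms may repeat without bound, the bounded displacement claim is false. *)

(* Defs.v *)
From mathcomp Require Import all_boot all_order all_algebra.
From mathcomp Require Import all_classical all_reals all_analysis.

Set Implicit Arguments.
Unset Strict Implicit.
Unset Printing Implicit Defensive.

Import Order.TTheory GRing.Theory Num.Theory.
Import numFieldNormedType.Exports.

Local Open Scope classical_set_scope.
Local Open Scope ring_scope.

(* Words in n letters and their inverses: (false, i) is the i-th letter and
   (true, i) its formal inverse. *)
Definition letter (n : nat) : Type := (bool * 'I_n)%type.
Definition word (n : nat) : Type := seq (letter n).

Definition inv_letter (n : nat) (l : letter n) : letter n := (~~ l.1, l.2).

Definition eval_word (G : groupType) (n : nat) (g : 'I_n -> G) (w : word n) : G :=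
  (\prod_(l <- w) (if l.1 then (g l.2)^-1 else g l.2))%g.

(* The congruence on words whose quotient is the group given by the
   presentation < x_0, ..., x_(n-1) | r, r in rels >. *)
Inductive pres_eq (n : nat) (rels : seq (word n)) : word n -> word n -> Prop :=
| pres_refl u : pres_eq rels u u
| pres_sym u v : pres_eq rels u v -> pres_eq rels v u
| pres_trans u v w : pres_eq rels u v -> pres_eq rels v w -> pres_eq rels u w
| pres_cancel u v l : pres_eq rels (u ++ [:: l; inv_letter l] ++ v) (u ++ v)
| pres_relator u v r : r \in rels -> pres_eq rels (u ++ r ++ v) (u ++ v).

Definition finitely_presented (G : groupType) : Prop :=
  exists (n : nat) (g : 'I_n -> G) (rels : seq (word n)),
    (forall x : G, exists w : word n, eval_word g w = x) /\
    (forall u v : word n, eval_word g u = eval_word g v <-> pres_eq rels u v).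

Definition subgroup (G : groupType) (A : set G) : Prop :=
  A 1%g /\ (forall x y, A x -> A y -> A (x / y)%g).

Definition generates (G : groupType) (S : seq G) : Prop :=
  forall A : set G, subgroup A -> (forall s, s \in S -> A s) -> A = setT.

Definition normal_subgroup (G : groupType) (A : set G) : Prop :=
  subgroup A /\ (forall x g, A x -> A (x ^ g)%g).

Definition lcoset (G : groupType) (A : set G) (g : G) : set G :=
  [set (g * a)%g | a in A].

Definition cosets (G : groupType) (A : set G) : set (set G) := range (lcoset A).

Definition finite_index (G : groupType) (A : set G) : Prop :=
  finite_set (cosets A).

Definition filtration (G : groupType) (N : nat -> set G) : Prop :=
  [/\ (forall i, N i.+1 `<=` N i),
      (forall i, normal_subgroup (N i)),
      (forall i, finite_index (N i)) &
      \bigcap_i N i = [set 1%g]].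

(* No term is repeated, except possibly the trivial subgroup: the terms of a
   filtration of a finite group are eventually trivial, those of a filtration
   of an infinite group never are.  With unboundedly many
   repetitions, two coarsely equivalent box spaces can list two isomorphism
   types in exchanged blocks of growing lengths, which rules out any matching
   of bounded displacement. *)
Definition properly_nested (G : groupType) (N : nat -> set G) : Prop :=
  forall i, N i.+1 = N i -> N i = [set 1%g].

(* Two subgroups, possibly of different groups, are isomorphic; only the
   restriction of phi to A matters. *)
Definition subgroup_isog (G H : groupType) (A : set G) (B : set H) : Prop :=
  exists phi : G -> H,
    set_bij A B phi /\ (forall x y, A x -> A y -> phi (x * y)%g = (phi x * phi y)%g).

(* For N normal and C = gN, the set C s is the coset (g s)N.  An edge path of
   this graph that starts at a coset of N visits only cosets of N, so the
   component of N in it is the Cayley graph of G/N. *)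
Definition cayley_adj (G : groupType) (S : seq G) (C D : set G) : Prop :=
  exists s : G, s \in S /\
    (D = [set (x * s)%g | x in C] \/ C = [set (x * s)%g | x in D]).

Definition path_lengths (G : groupType) (S : seq G) (C D : set G) : set nat :=
  [set size p | p in [set p : seq (set G) |
     path (fun X Y => `[< cayley_adj S X Y >]) C p /\ last C p = D]].

Definition cayley_dist (R : realType) (G : groupType) (S : seq G) (C D : set G) : R :=
  inf [set k%:R | k in path_lengths S C D].

Definition cayley_diam (R : realType) (G : groupType) (S : seq G) (A : set G) : R :=
  sup [set cayley_dist R S C D | C in cosets A & D in cosets A].

Definition box_space (G : groupType) (N : nat -> set G) : Type :=
  {i : nat & {C : set G | cosets (N i) C}}.

Definition box_index (G : groupType) (N : nat -> set G) (x : box_space N) : nat :=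
  projT1 x.

Definition box_coset (G : groupType) (N : nat -> set G) (x : box_space N) : set G :=
  proj1_sig (projT2 x).

Definition box_dist (R : realType) (G : groupType) (S : seq G) (N : nat -> set G)
    (x y : box_space N) : R :=
  if box_index x == box_index y then cayley_dist R S (box_coset x) (box_coset y)
  else cayley_diam R S (N (box_index x)) + cayley_diam R S (N (box_index y)).

(* rho stands for a function from [0, +oo[ to itself; its values at negative
   reals are irrelevant.  Proper is meant in the coarse sense: preimages of
   bounded sets are bounded. *)
Definition proper_nneg (R : realType) (rho : R -> R) : Prop :=
  (forall t, 0 <= t -> 0 <= rho t) /\
  (forall B : set R, bounded_set B ->
     bounded_set [set t : R | 0 <= t /\ B (rho t)]).

Definition coarse_embedding (R : realType) (X Y : Type)
    (dX : X -> X -> R) (dY : Y -> Y -> R) (phi : X -> Y) : Prop :=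
  exists rho_minus rho_plus : R -> R,
    [/\ proper_nneg rho_minus, proper_nneg rho_plus &
        forall a b : X,
          rho_minus (dX a b) <= dY (phi a) (phi b) <= rho_plus (dX a b)].

Definition coarse_equivalence (R : realType) (X Y : Type)
    (dX : X -> X -> R) (dY : Y -> Y -> R) (phi : X -> Y) : Prop :=
  coarse_embedding dX dY phi /\
  (exists C : R, 0 < C /\ (forall y : Y, exists x : X, dY y (phi x) <= C)).

Definition coarsely_equivalent (R : realType) (X Y : Type)
    (dX : X -> X -> R) (dY : Y -> Y -> R) : Prop :=
  exists phi : X -> Y, coarse_equivalence dX dY phi.

(* f is considered on its domain D only, and E is its range. *)
Definition almost_permutation (D E : set nat) (f : nat -> nat) : Prop :=
  [/\ finite_set (~` D), finite_set (~` E) & set_bij D E f].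

Definition bounded_displacement (D : set nat) (f : nat -> nat) : Prop :=
  exists A n0 : nat, forall n : nat, D n -> (n0 <= n)%N ->
    `|(f n)%:Z - n%:Z| <= A%:Z.

(* Main.v *)
(* For large i the coarse equivalence carries the component G/N_i into a single
   component H/M_(c i), with constants independent of i.  Since H -> H/M_(c i)
   is injective on large balls, such a map lifts to a map F : G -> H as soon as
   G is simply connected at a large scale, which finite presentability provides.
   Large scale simple connectedness is used in cohomological form: every
   group-valued cocycle defined on pairs of bounded distance has a primitive.
   In this form it passes from G to H, because the lifts of arbitrarily high
   level are coarse equivalences on arbitrarily large balls.  A coarse inverse
   of G/N_i -> H/M_(c i) therefore lifts as well, and F, which commutes with the
   actions by translation, restricts to an isomorphism from N_i to M_(c i).

   The index of M_(c i) agrees with that of N_i up to a bounded factor, whereas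
   the indices of the N_i at least double at each step; so c is increasing along
   steps of bounded length, and being almost a bijection of the natural numbers
   it has bounded displacement. *)

Require Import Defs.
From mathcomp Require Import all_boot all_order all_algebra.
From mathcomp Require Import all_classical all_reals all_analysis.
From mathcomp Require Import zify.

Import Order.TTheory GRing.Theory Num.Theory.

Set Implicit Arguments.
Unset Strict Implicit.
Unset Printing Implicit Defensive.

(** * Word balls, congruences and cocycles *)

Lemma seq_bounded (T : eqType) (f : T -> nat) (s : seq T) :
  exists m, forall x, x \in s -> f x <= m.
Proof.
elim: s => [|x s [m Hm]]; first by exists 0.
exists (maxn (f x) m) => y; rewrite inE leq_max => /orP[/eqP -> | /Hm ->].
  by rewrite leqnn.
by rewrite orbT.
Qed.

Section Balls.
Local Open Scope classical_set_scope.
Local Open Scope group_scope.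
Context (G : groupType) (S : seq G).
Implicit Types (x y z : G) (A : set G).

Definition sym_gens : seq G := S ++ [seq s^-1 | s <- S].

(** The ball of radius [k] about 1 in the word metric, as a list with repetitions; only membership
    and an upper bound on its size matter. *)
Fixpoint wball (k : nat) : seq G :=
  if k is k'.+1 then wball k' ++ [seq x * s | x <- wball k', s <- sym_gens]
  else [:: 1].

Lemma sym_gensV s : s \in sym_gens -> s^-1 \in sym_gens.
Proof.
rewrite !mem_cat => /orP[sS | /mapP[t tS ->]].
  by rewrite map_f ?orbT.
by rewrite invgK tS.
Qed.

Lemma ballS k x : x \in wball k.+1 ->
  x \in wball k \/ exists y s, [/\ y \in wball k, s \in sym_gens & x = y * s].
Proof.
rewrite /= mem_cat => /orP[|/allpairsP[[y s] [yk sS ->]]]; first by left.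
by right; exists y, s.
Qed.

Lemma ball_step k x s : x \in wball k -> s \in sym_gens -> x * s \in wball k.+1.
Proof.
by move=> xk sS; rewrite /= mem_cat; apply/orP; right; apply: allpairs_f.
Qed.

Lemma ball1 k : 1 \in wball k.
Proof. by elim: k => [|k IH] /=; rewrite ?inE // mem_cat IH. Qed.

Lemma ball_leq j k x : j <= k -> x \in wball j -> x \in wball k.
Proof.
move=> /subnK <- xj; elim: (k - j) => [|n IH] //=.
by rewrite mem_cat IH.
Qed.

Lemma ballM j k x y : x \in wball j -> y \in wball k -> x * y \in wball (j + k).
Proof.
move=> xj; elim: k y => [|k IH] y.
  by rewrite addn0 inE => /eqP ->; rewrite mulg1.
case/ballS => [/IH|[z [s [/IH zk sS ->]]]].
  by apply: ball_leq; rewrite addnS.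
by rewrite mulgA addnS; apply: ball_step.
Qed.

Lemma ball_sym s : s \in sym_gens -> s \in wball 1.
Proof. by move=> sS; rewrite -[s]mul1g; apply: ball_step => //; apply: ball1. Qed.

Lemma ball_gen s : s \in S -> s \in wball 1.
Proof. by move=> sS; apply: ball_sym; rewrite mem_cat sS. Qed.

Lemma ballV k x : x \in wball k -> x^-1 \in wball k.
Proof.
elim: k x => [|k IH] x; first by rewrite !inE => /eqP ->; rewrite invg1.
case/ballS => [/IH|[z [s [/IH zk sS ->]]]]; first by apply: ball_leq.
by rewrite invgM -add1n; apply: ballM => //; apply/ball_sym/sym_gensV.
Qed.

Lemma generates_ball : generates S -> forall x, exists k, x \in wball k.
Proof.
move=> /(_ [set x | exists k, x \in wball k]) gS x.
suff: [set x | exists k, x \in wball k] x by [].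
rewrite gS //.
  split=> [|y z [j yj] [k zk]]; first by exists 0; apply: ball1.
  by exists (j + k); apply/ballM/ballV.
by move=> s sS; exists 1%N; apply: ball_gen.
Qed.

(** The elements by which right multiplication preserves and reflects [P] form a subgroup. As the
    step is an equivalence, inverses of generators need no separate case. *)
Lemma generates_ind (P : G -> Prop) : generates S ->
  P 1 -> (forall x s, s \in S -> P x <-> P (x * s)) -> forall x, P x.
Proof.
move=> gS P1 PS x.
have : [set x | forall y, P y <-> P (y * x)] x.
  rewrite (gS [set x | forall y, P y <-> P (y * x)]) //; last first.
    by move=> s sS y; apply: PS.
  split=> [y|y z /= Hy Hz t]; first by rewrite mulg1.
  by rewrite (Hz (t * (y / z))) -mulgA mulgVK; apply: Hy.
by move=> /(_ 1) /=; rewrite mul1g => <-.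
Qed.

Lemma seq_ball (F : seq G) : generates S ->
  exists k, forall x, x \in F -> x \in wball k.
Proof.
move=> /generates_ball /choice[f Hf].
have [m Hm] := seq_bounded f F.
by exists m => x xF; apply: ball_leq (Hf x); apply: Hm.
Qed.

Definition eqmod A x y := A (x^-1 * y).

(** For normal [A], this is distance at most [k] between the cosets of [x] and [y] in the Cayley
    graph of the quotient by [A]. *)
Definition near_mod A k x y := exists2 b, b \in wball k & eqmod A (x * b) y.

Section Mod.
Context (A : set G) (nA : normal_subgroup A).

Lemma subgroupV x : A x -> A x^-1.
Proof. by case: nA => -[A1 AD] _ Ax; rewrite -[_^-1]mul1g; apply: AD. Qed.

Lemma subgroupM x y : A x -> A y -> A (x * y).
Proof.
by case: nA => -[A1 AD] _ Ax Ay; rewrite -[y]invgK; apply: AD => //; exact: subgroupV.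
Qed.

Lemma normalJ x y : A x -> A (y^-1 * x * y).
Proof. by case: nA => _ AJ Ax; rewrite -mulgA; apply: AJ. Qed.

Lemma eqmod_refl x : eqmod A x x.
Proof. by rewrite /eqmod mulVg; case: nA => -[]. Qed.

Lemma eqmod_sym x y : eqmod A x y -> eqmod A y x.
Proof. by move=> /subgroupV; rewrite /eqmod invgM invgK. Qed.

Lemma eqmod_trans y x z : eqmod A x y -> eqmod A y z -> eqmod A x z.
Proof. by move=> xy yz; have := subgroupM xy yz; rewrite /eqmod mulgA mulgK. Qed.

Lemma eqmodMl z x y : eqmod A x y -> eqmod A (z * x) (z * y).
Proof. by rewrite /eqmod ?gnorm. Qed.

Lemma eqmodMr z x y : eqmod A x y -> eqmod A (x * z) (y * z).
Proof. by move=> /(@normalJ _ z); rewrite /eqmod ?gnorm. Qed.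

Lemma eqmodM x y z t : eqmod A x y -> eqmod A z t -> eqmod A (x * z) (y * t).
Proof. by move=> xy zt; apply: eqmod_trans (eqmodMr _ xy) (eqmodMl _ zt). Qed.

Lemma eqmodV x y : eqmod A x y -> eqmod A x^-1 y^-1.
Proof.
move=> /eqmod_sym /(eqmodMr y^-1) /(eqmodMl x^-1).
by rewrite mulgV mulg1 mulKg.
Qed.

Lemma near_mod_refl k x : near_mod A k x x.
Proof. by exists 1; rewrite ?ball1 // mulg1; apply: eqmod_refl. Qed.

Lemma near_mod_eqmod k x y : eqmod A x y -> near_mod A k x y.
Proof. by exists 1; rewrite ?ball1 // mulg1. Qed.

Lemma near_mod_ball k x y : x^-1 * y \in wball k -> near_mod A k x y.
Proof. by move=> ?; exists (x^-1 * y) => //; rewrite mulVKg; apply: eqmod_refl. Qed.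

Lemma near_mod_sym k x y : near_mod A k x y -> near_mod A k y x.
Proof.
case=> b bk H; exists b^-1; first exact: ballV.
by apply: eqmod_sym; rewrite -[x](mulgK b); apply: eqmodMr.
Qed.

Lemma near_mod_trans j k y x z :
  near_mod A j x y -> near_mod A k y z -> near_mod A (j + k) x z.
Proof.
move=> [b bj xy] [c ck yz]; exists (b * c); first exact: ballM.
by apply: eqmod_trans yz; rewrite mulgA; apply: eqmodMr.
Qed.

Lemma near_mod_leq j k x y : j <= k -> near_mod A j x y -> near_mod A k x y.
Proof. by move=> jk [b bj xy]; exists b => //; apply: ball_leq bj. Qed.

Lemma near_mod_eql k x x' y : eqmod A x x' -> near_mod A k x y -> near_mod A k x' y.
Proof.
move=> /eqmod_sym x'x xy; rewrite -[k]add0n.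
exact: near_mod_trans (near_mod_eqmod _ x'x) xy.

Qed.

Lemma near_mod_eqr k x y y' : eqmod A y y' -> near_mod A k x y -> near_mod A k x y'.
Proof. by move=> yy' xy; rewrite -[k]addn0; apply: near_mod_trans xy (near_mod_eqmod _ yy'). Qed.

(** The element [b^-1 * c] lies both in [A] and in the ball of radius [R]. This is the tool that
    upgrades congruences between short elements to equalities. *)
Lemma eqmod_ball_eq R j k b c : (forall x, A x -> x \in wball R -> x = 1) ->
  j + k <= R -> b \in wball j -> c \in wball k -> eqmod A b c -> b = c.
Proof.
move=> AR jkR bj ck bc; apply: invg_inj; apply: divg1_eq; rewrite invgK.
by apply: AR => //; apply: ball_leq jkR _; apply: ballM ck; apply: ballV.
Qed.

End Mod.

(** A 1-cocycle on the Rips complex of scale [s], with values in a possibly non-abelian group;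
    values at more distant pairs are irrelevant. *)
Definition is_cocycle (K : groupType) s (a : G -> G -> K) :=
  forall x y z, x^-1 * y \in wball s -> y^-1 * z \in wball s ->
    x^-1 * z \in wball s -> a x y * a y z = a x z.

Definition is_primitive (K : groupType) s (a : G -> G -> K) (b : G -> K) :=
  forall x y, x^-1 * y \in wball s -> b y = b x * a x y.

Definition cocycles_split s (K : groupType) := forall a : G -> G -> K,
  is_cocycle s a -> exists b : G -> K, is_primitive s a b.

Lemma cocycle1 (K : groupType) s (a : G -> G -> K) x : is_cocycle s a -> a x x = 1.
Proof.
move=> /(_ x x x); rewrite mulVg !ball1 => /(_ isT isT isT) E.
by apply: (mulgI (a x x)); rewrite mulg1.
Qed.

(** The initial segments of a word of length at most [s] stay in the ball of radius [s], so the
    cocycle identity absorbs one edge at a time. Inverse edges are handled by the identity for a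
    step back and forth. *)
Lemma is_primitive_gens (K : groupType) s (a : G -> G -> K) (b : G -> K) :
  is_cocycle s a -> 0 < s -> (forall x g, g \in S -> b (x * g) = b x * a x (x * g)) ->
  is_primitive s a b.
Proof.
move=> ca s0 bS.
have bsym x g : g \in sym_gens -> b (x * g) = b x * a x (x * g).
  move=> gS; have g1 : g \in wball s by apply: ball_leq s0 (ball_sym gS).
  move: (gS); rewrite mem_cat => /orP[/bS //|/mapP[h hS gh]].
  have := bS (x * g) h hS; rewrite gh mulgVK => ->.
  rewrite -mulgA (ca (x * h^-1) x (x * h^-1)) ?(cocycle1 _ ca) ?mulg1 //.
  - by rewrite invgM -mulgA mulVg mulg1; apply/ballV; rewrite -gh.
  - by rewrite mulKg -gh.
  - by rewrite mulVg ball1.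
suff H k : k <= s -> forall x w, w \in wball k -> b (x * w) = b x * a x (x * w).
  by move=> x y xy; have := H s (leqnn s) x _ xy; rewrite mulVKg.
elim: k => [_ x w|k IH ks x w].
  by rewrite inE => /eqP ->; rewrite mulg1 (cocycle1 _ ca) mulg1.
case/ballS=> [wk|[v [g [vk gS ->]]]]; first by apply: IH => //; apply: ltnW.
rewrite mulgA bsym // IH ?(ltnW ks) // -[LHS]mulgA ca // ?mulKg.
- by apply: ball_leq vk; apply: ltnW.
- by apply: ball_leq s0 (ball_sym gS).
- by rewrite -mulgA mulKg; apply: ball_leq ks _; apply: ball_step.
Qed.

(** A primitive at scale [s] is correct on generator edges, which by [is_primitive_gens] is enough
    at scale [s']. *)
Lemma cocycles_split_leq s s' (K : groupType) : 0 < s -> s <= s' ->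
  cocycles_split s K -> cocycles_split s' K.
Proof.
move=> s0 ss' H a ca; have [|b pb] := H a.
  by move=> x y z xy yz xz; apply: ca; apply: ball_leq ss' _.
exists b; apply: is_primitive_gens => //; first exact: leq_trans ss'.
by move=> x g gS; apply: pb; rewrite mulKg; apply: ball_leq (ball_gen gS).
Qed.

End Balls.

(** * Splitting of cocycles on a finitely presented group *)

Section FinitelyPresented.
Local Open Scope classical_set_scope.
Local Open Scope group_scope.
Context (G : groupType).

Definition letter_val n (g : 'I_n -> G) (l : letter n) :=
  if l.1 then (g l.2)^-1 else g l.2.

Lemma letter_valV n (g : 'I_n -> G) l :
  letter_val g (inv_letter l) = (letter_val g l)^-1.
Proof. by case: l => -[] i; rewrite /letter_val //= invgK. Qed.

Lemma eval_word_cons n (g : 'I_n -> G) l w :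
  eval_word g (l :: w) = letter_val g l * eval_word g w.
Proof. exact: big_cons. Qed.

Lemma eval_word_cat n (g : 'I_n -> G) u v :
  eval_word g (u ++ v) = eval_word g u * eval_word g v.
Proof. exact: big_cat. Qed.

Fixpoint holonomy (K : groupType) (a : G -> G -> K) n (g : 'I_n -> G)
    (x : G) (w : word n) : K :=
  if w is l :: w' then
    a x (x * letter_val g l) * holonomy a g (x * letter_val g l) w'
  else 1.

Lemma holonomy_cat (K : groupType) (a : G -> G -> K) n (g : 'I_n -> G) x u v :
  holonomy a g x (u ++ v) =
  holonomy a g x u * holonomy a g (x * eval_word g u) v.
Proof.
elim: u x => [|l u IH] x /=.
  by rewrite mul1g /eval_word big_nil mulg1.
by rewrite IH eval_word_cons !mulgA.
Qed.

(** Holonomy along a short word is the value of the cocycle at its endpoints, so cancelling pairs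
    and relators contribute nothing. Holonomy from 1 therefore depends only on the endpoint, and is
    a primitive. *)
Lemma cocycles_split_finitely_presented (S : seq G) :
  finitely_presented G -> generates S ->
  exists2 s, 0 < s & forall K : groupType, cocycles_split S s K.
Proof.
move=> [n [g [rels [surj eqP]]]] gS.
have [W HW] := choice surj.
have [c Hc] := seq_ball [seq letter_val g l | l : (bool * 'I_n)%type] gS.
have lc l : letter_val g l \in wball S c by apply: Hc; apply: map_f; rewrite mem_enum.
have [m Hm] := seq_bounded size rels.
have [m' Hm'] := seq_bounded (fun x => size (W x)) S.
(* [c] bounds the [S]-length of a letter, [m] the size of a relator, [m'] the size of the word
   chosen for a generator in [S]; 2 is the size of a cancelling pair. *)
pose s := (c * (m + m' + 2)).+1; exists s => // K a ca.
have sM k : k <= m + m' + 2 -> c * k <= s.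
  by move=> km; rewrite leqW // leq_mul2l km orbT.
have evalc w : eval_word g w \in wball S (c * size w).
  elim: w => [|l w IH]; first by rewrite /eval_word big_nil ball1.
  by rewrite eval_word_cons mulnS; apply: ballM.
have short w x : c * size w <= s -> holonomy a g x w = a x (x * eval_word g w).
  elim: w x => [|l w IH] x ws; first by rewrite /eval_word big_nil mulg1 (cocycle1 _ ca).
  rewrite /= IH; last by apply: leq_trans ws; rewrite leq_mul2l leqnSn orbT.
  rewrite eval_word_cons mulgA ca //.
  - rewrite mulKg; apply: ball_leq (lc l); apply: leq_trans ws.
    by rewrite mulnS leq_addr.
  - rewrite mulKg; apply: ball_leq (evalc w); apply: leq_trans ws.
    by rewrite mulnS leq_addl.
  - by rewrite -mulgA mulKg -eval_word_cons; apply: ball_leq ws (evalc _).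
have hol u v : pres_eq rels u v -> forall x, holonomy a g x u = holonomy a g x v.
  elim=> {u v} [//|u v _ IH x|u v w _ IH1 _ IH2 x|u v l x|u v r rr x].
  - by rewrite IH.
  - by rewrite IH1.
  - have E : eval_word g [:: l; inv_letter l] = 1.
      by rewrite !eval_word_cons letter_valV /eval_word big_nil mulg1 mulgV.
    rewrite !holonomy_cat E mulg1 (short [:: l; inv_letter l]) ?E; last first.
      by apply: sM; rewrite leq_addl.
    by rewrite mulg1 (cocycle1 _ ca) mul1g.
  - have E : eval_word g r = 1.
      have := pres_relator [::] [::] rr; rewrite !cats0 /= => /eqP ->.
      by rewrite /eval_word big_nil.
    rewrite !holonomy_cat E mulg1 (short r) ?E ?mulg1 ?(cocycle1 _ ca) ?mul1g //.
    by apply: sM; apply: leq_trans (Hm r rr) _; rewrite -addnA leq_addr.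
exists (fun x => holonomy a g 1 (W x)).
apply: is_primitive_gens => // x y yS.
rewrite (hol _ (W x ++ W y)); last by apply/eqP; rewrite eval_word_cat !HW.
rewrite holonomy_cat mul1g HW (short (W y)) ?HW //.
by apply: sM; apply: leq_trans (Hm' y yS) _; rewrite addnAC leq_addl.
Qed.

End FinitelyPresented.

(** * Lifting maps between quotients *)

Section Lifting.
Local Open Scope classical_set_scope.
Local Open Scope group_scope.
Context (G H : groupType) (S : seq G) (T : seq H).

Lemma near_mod_path (M : set H) L (f : G -> H) : normal_subgroup M ->
  (forall x g, g \in S -> near_mod T M L (f x) (f (x * g))) ->
  forall k x y, x^-1 * y \in wball S k -> near_mod T M (L * k) (f x) (f y).
Proof.
move=> nM fS k x y xy.
suff : forall w, w \in wball S k -> near_mod T M (L * k) (f x) (f (x * w)).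
  by move=> /(_ _ xy); rewrite mulVKg.
elim: k {xy} => [|k IH] w.
  by rewrite inE => /eqP ->; rewrite mulg1; apply: near_mod_refl.
case/ballS=> [/IH|[v [g [/IH vk gS ->]]]].
  by apply: near_mod_leq; rewrite leq_mul2l leqnSn orbT.
rewrite mulnS addnC; apply: near_mod_trans vk _ => //.
move: gS; rewrite mem_cat mulgA => /orP[/fS //|/mapP[h hS ->]].
by apply: near_mod_sym => //; have := fS (x * v * h^-1) h hS; rewrite mulgVK.
Qed.

Lemma lipschitz_path A (F : G -> H) :
  (forall x g, g \in S -> (F x)^-1 * F (x * g) \in wball T A) ->
  forall k x y, x^-1 * y \in wball S k -> (F x)^-1 * F y \in wball T (A * k).
Proof.
move=> FS k x y xy.
suff : forall w, w \in wball S k -> (F x)^-1 * F (x * w) \in wball T (A * k).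
  by move=> /(_ _ xy); rewrite mulVKg.
elim: k {xy} => [|k IH] w.
  by rewrite inE => /eqP ->; rewrite mulg1 mulVg ball1.
case/ballS=> [/IH|[v [g [/IH vk gS ->]]]].
  by apply: ball_leq; rewrite leq_mul2l leqnSn orbT.
have -> : (F x)^-1 * F (x * (v * g)) =
    ((F x)^-1 * F (x * v)) * ((F (x * v))^-1 * F (x * v * g)).
  by rewrite -[RHS]mulgA mulVKg mulgA.
rewrite mulnS addnC; apply: ballM => //.
move: gS; rewrite mem_cat => /orP[/FS //|/mapP[h hS ->]].
have := ballV (FS (x * v * h^-1) h hS).
by rewrite invgM invgK mulgVK.
Qed.

(* [M] meets the ball of radius [3 L s] trivially, so the short element of [H]
   carrying [f x M] to [f y M] is unique; these elements form a cocycle, and a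
   primitive of it is the lift. *)
Lemma lift_mod s L (M : set H) (f : G -> H) :
  generates S -> 0 < s -> cocycles_split S s H -> normal_subgroup M ->
  (forall m, M m -> m \in wball T (3 * (L * s)) -> m = 1) ->
  (forall x g, g \in S -> near_mod T M L (f x) (f (x * g))) ->
  exists F : G -> H, [/\ forall x, eqmod M (f x) (F x), F 1 = f 1 &
    forall k x y, x^-1 * y \in wball S k -> (F x)^-1 * F y \in wball T (L * s * k)].
Proof.
move=> gS s0 spl nM Minj fS.
have /choice[a Ha] (p : G * G) : exists b, p.1^-1 * p.2 \in wball S s ->
    b \in wball T (L * s) /\ eqmod M (f p.1 * b) (f p.2).
  have [pS|] := boolP (p.1^-1 * p.2 \in wball S s); last by exists 1.
  by have [b bT fb] := near_mod_path nM fS pS; exists b.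
have ca : is_cocycle S s (fun x y => a (x, y)).
  move=> x y z /(Ha (x, y)) /= [xy fxy] /(Ha (y, z)) /= [yz fyz].
  move=> /(Ha (x, z)) /= [xz fxz].
  apply: (eqmod_ball_eq Minj _ (ballM xy yz) xz); first by lia.
  have /(eqmodMl (f x)^-1) : eqmod M (f x * (a (x, y) * a (y, z))) (f x * a (x, z)).
    apply: (eqmod_trans nM _ (eqmod_sym nM fxz)).
    by apply: eqmod_trans fyz => //; rewrite mulgA; apply: eqmodMr.
  by rewrite !mulKg.
have [b pb] := spl _ ca.
(* Left translation keeps the increments of [b] and normalises [F 1] to [f 1]. *)
pose F x := f 1 * (b 1)^-1 * b x.
have Fa x y : (F x)^-1 * F y = (b x)^-1 * b y.
  by rewrite /F (invgM _ (b x)) -[LHS]mulgA mulKg.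
exists F; split; last 2 first.
- by rewrite /F mulgVK.
- apply: lipschitz_path => x g gSS.
  have gs : x^-1 * (x * g) \in wball S s.
    by rewrite mulKg; apply: ball_leq (ball_gen gSS).
  by rewrite Fa (pb _ _ gs) mulKg; apply: (Ha (x, _) gs).1.
apply: (generates_ind gS) => [|x g gSS].
  by rewrite /F mulgVK; apply: eqmod_refl.
have gs : x^-1 * (x * g) \in wball S s by rewrite mulKg; apply: ball_leq (ball_gen gSS).
have [_ /= fa] := Ha (x, x * g) gs.
have -> : F (x * g) = F x * a (x, x * g) by rewrite /F (pb _ _ gs) mulgA.
split=> [fF|fF].
  by apply: (eqmod_trans nM (eqmod_sym nM fa)); apply: eqmodMr.
rewrite -[f x](mulgK (a (x, x * g))) -[F x](mulgK (a (x, x * g))).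
by apply: eqmodMr => //; apply: eqmod_trans fF.
Qed.

End Lifting.

(** * From coarse maps between quotients to isomorphic subgroups *)

Section QuotientMaps.
Local Open Scope classical_set_scope.
Local Open Scope group_scope.

(* [f] represents a map G/N -> H/M, in coset representatives. *)
Record coarse_quotient_map (G H : groupType) (S : seq G) (T : seq H)
    (L : nat) (P : nat -> nat) (C R : nat) (N : set G) (M : set H)
    (f : G -> H) : Prop := CoarseQuotientMap {
  cqm_normal_dom : normal_subgroup N;
  cqm_normal_cod : normal_subgroup M;
  cqm_inj_dom : forall n, N n -> n \in wball S R -> n = 1;
  cqm_inj_cod : forall m, M m -> m \in wball T R -> m = 1;
  cqm1 : f 1 = 1;
  cqm_mod : forall x y, eqmod N x y -> f x = f y;
  cqm_upper : forall x g, g \in S -> near_mod T M L (f x) (f (x * g));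
  cqm_lower : forall k x y, near_mod T M k (f x) (f y) -> near_mod S N (P k) x y;
  cqm_surj : forall h, exists x, near_mod T M C h (f x) }.

Context (G H : groupType) (S : seq G) (T : seq H).
Context (L : nat) (P : nat -> nat) (C s : nat).
Hypotheses (gS : generates S) (gT : generates T) (s0 : 0 < s).
Hypothesis splitG : forall K : groupType, cocycles_split S s K.

(** [A] is the Lipschitz constant of a lift. [D] bounds the distance in G/N between approximate
    preimages of neighbours in H/M, whose images are within [C + 1 + C]. *)
Let A := (L * s)%N.
Let D := P (2 * C + 1)%N.

Lemma cqm_lift R N M f : coarse_quotient_map S T L P C R N M f -> 3 * A <= R ->
  exists F : G -> H, [/\ forall x, eqmod M (f x) (F x), F 1 = 1 &
    forall k x y, x^-1 * y \in wball S k -> (F x)^-1 * F y \in wball T (A * k)].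
Proof.
move=> cqm AR; rewrite -(cqm1 cqm); apply: lift_mod => //.
- exact: cqm_normal_cod cqm.
- by move=> m Mm mb; apply: (cqm_inj_cod cqm) => //; apply: ball_leq mb.
- exact: cqm_upper cqm.
Qed.

Lemma cqm_lower_gen R N M f h h' x x' : coarse_quotient_map S T L P C R N M f ->
  h^-1 * h' \in wball T 1 -> near_mod T M C h (f x) -> near_mod T M C h' (f x') ->
  near_mod S N D x x'.
Proof.
move=> cqm hh' hx hx'; have nM := cqm_normal_cod cqm; apply: (cqm_lower cqm).
have := near_mod_trans nM (near_mod_trans nM (near_mod_sym nM hx)
  (near_mod_ball nM hh')) hx'.
by apply: near_mod_leq; lia.
Qed.

(** Induction along a word for [h]: the next approximate preimage is within [D] of the current one
    modulo [N], so it has a representative [x * b] with [b] short. The resulting congruence modulo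
    [M] is between elements at distance at most [R], hence an equality. The bound on [R] does not
    involve [k]. *)
Lemma cqm_lift_surj R N M f (F : G -> H) :
  coarse_quotient_map S T L P C R N M f -> A * D + 2 * C + 1 <= R ->
  (forall x, eqmod M (f x) (F x)) -> F 1 = 1 ->
  (forall k x y, x^-1 * y \in wball S k -> (F x)^-1 * F y \in wball T (A * k)) ->
  forall k h, h \in wball T k ->
  exists x, x \in wball S (D * k) /\ (F x)^-1 * h \in wball T C.
Proof.
move=> cqm DR fF F1 FA; have nM := cqm_normal_cod cqm.
elim=> [h|k IH h].
  by rewrite inE => /eqP ->; exists 1; rewrite ball1 F1 mulVg ball1.
case/ballS=> [/IH[x [xk xh]]|[h' [e [/IH[x [xk xh]] eT ->]]]].
  by exists x; split=> //; apply: ball_leq xk; rewrite leq_mul2l leqnSn orbT.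
have [y hy] := cqm_surj cqm (h' * e).
have hx : near_mod T M C h' (f x).
  apply: near_mod_sym => //; apply: near_mod_eql (near_mod_ball _ xh) => //.
  exact: eqmod_sym.
have [] := cqm_lower_gen cqm _ hx hy; first by rewrite mulKg; apply: ball_sym.
move=> b bD xby; exists (x * b); split; first by rewrite mulnS addnC; apply: ballM.
have [c cC hc] := hy.
have Ec : eqmod M (F (x * b)) (h' * e * c).
  apply: (eqmod_trans nM (eqmod_sym nM (fF _))).
  by rewrite (cqm_mod cqm xby); apply: eqmod_sym.
have E : (F (x * b))^-1 * (h' * e * c) = 1.
  apply: (cqm_inj_cod cqm) => //; apply: ball_leq DR _.
  have -> : (F (x * b))^-1 * (h' * e * c) =
     ((F (x * b))^-1 * F x) * ((F x)^-1 * h') * e * c.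
    by rewrite !mulgA mulgK.
  have -> : (A * D + 2 * C + 1 = A * D + C + 1 + C)%N by lia.
  apply: ballM => //; apply: ballM; last exact: ball_sym.
  by apply: ballM => //; apply: FA; rewrite invgM mulgVK; apply: ballV.
suff -> : (F (x * b))^-1 * (h' * e) = c^-1 by apply: ballV.
by apply: (mulIg c); rewrite mulVg -mulgA.
Qed.

(* Vanishing of cocycles passes from G to H: a cocycle on H is pulled back to G
   along a lift, split there, and pushed forward to a large ball of H, on which
   the lift has a coarse inverse.  The level is chosen after the ball. *)
Lemma cocycles_split_transfer :
  (forall R, exists N M f, coarse_quotient_map S T L P C R N M f) ->
  exists2 s', 0 < s' & forall K : groupType, cocycles_split T s' K.
Proof.
move=> cqms; pose s1 := maxn s D.
have s1s : s <= s1 by rewrite leq_maxl.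
pose s' := (A * s1 + 2 * C + 1)%N.
exists s'; first by rewrite /s'; lia.
move=> K a ca.
have loc k : exists b : H -> K, b 1 = 1 /\ forall h t, t \in T ->
    h \in wball T k -> h * t \in wball T k -> b (h * t) = b h * a h (h * t).
  (* The summands serve the lift, [cqm_lift_surj], and the passage from nearness in G/N to nearness
     in G for approximate preimages of points of the [k]-ball. *)
  pose R := (3 * A + (A * D + 2 * C + 1) + (2 * (D * k) + D))%N.
  have [N [M [f cqm]]] := cqms R.
  have nN := cqm_normal_dom cqm; have nM := cqm_normal_cod cqm.
  have [|F [fF F1 FA]] := cqm_lift cqm; first by rewrite /R; lia.
  have Fs1 x y : x^-1 * y \in wball S s1 -> (F x)^-1 * F y \in wball T s'.
    by move=> /FA; apply: ball_leq; rewrite /s'; lia.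
  have [|b pb] := cocycles_split_leq s0 s1s (@splitG K) (a := fun x y => a (F x) (F y)).
    by move=> x y z xy yz xz; apply: ca; apply: Fs1.
  have /choice[p Hp] h : exists x, h \in wball T k ->
      x \in wball S (D * k) /\ (F x)^-1 * h \in wball T C.
    have [hk|] := boolP (h \in wball T k); last by exists 1.
    have [|x Hx] := cqm_lift_surj cqm _ fF F1 FA hk; first by rewrite /R; lia.
    by exists x.
  (* The primitive on G at the approximate preimage [p h], transported from [F (p h)] to [h] by the
     cocycle. *)
  pose b' h := b (p h) * a (F (p h)) h.
  suff Hb' h t : t \in T -> h \in wball T k -> h * t \in wball T k ->
      b' (h * t) = b' h * a h (h * t).
    exists (fun h => (b' 1)^-1 * b' h); rewrite mulVg; split=> // h t tT hk htk.
    by rewrite Hb' // mulgA.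
  move=> tT hk htk; have [xk xh] := Hp h hk; have [xk' xh'] := Hp _ htk.
  rewrite /b'; set x := p h in xk xh *; set x' := p (h * t) in xk' xh' *.
  have near_f y g : (F y)^-1 * g \in wball T C -> near_mod T M C g (f y).
    move=> yg; apply: near_mod_sym => //; apply: near_mod_eql (near_mod_ball _ yg) => //.
    exact: eqmod_sym.
  have t1 : h^-1 * (h * t) \in wball T 1 by rewrite mulKg; apply: ball_gen.
  have [c cD xc] := cqm_lower_gen cqm t1 (near_f _ _ xh) (near_f _ _ xh').
  have xx' : x^-1 * x' \in wball S D.
    suff -> : x^-1 * x' = c by [].
    apply/esym/(eqmod_ball_eq (cqm_inj_dom cqm) _ cD (ballM (ballV xk) xk')).
      by rewrite /R; lia.
    by move: (eqmodMl x^-1 xc); rewrite mulKg.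
  have xx's1 : x^-1 * x' \in wball S s1 by apply: ball_leq xx'; rewrite leq_maxr.
  have sC g : g \in wball T C -> g \in wball T s' by apply: ball_leq; rewrite /s'; lia.
  have xht : (F x)^-1 * (h * t) \in wball T s'.
    rewrite mulgA; apply: ball_leq (ballM xh (ball_gen tT)).
    by rewrite /s'; lia.
  rewrite (pb x x') // -mulgA ca //; [|exact: Fs1|exact: sC].
  rewrite -[RHS]mulgA ca //; first exact: sC.
  by apply: ball_leq t1; rewrite /s'; lia.
have /choice[b Hb] := loc.
(* Balls are connected, so a primitive on a ball is determined by its value at 1; the normalised
   local primitives agree and glue. *)
have coh j k h : j <= k -> h \in wball T j -> b j h = b k h.
  move=> jk; have [bj1 bjT] := Hb j; have [bk1 bkT] := Hb k.
  suff : forall i, i <= j -> forall h, h \in wball T i -> b j h = b k h.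
    by apply.
  elim=> [_ g|i IH ij g]; first by rewrite inE => /eqP ->; rewrite bj1.
  case/ballS=> [|[v [t [vi tT ->]]]]; first by apply: IH; exact: ltnW.
  have vj : v \in wball T j by apply: ball_leq vi; apply: ltnW.
  have vtj : v * t \in wball T j by apply: ball_leq ij _; apply: ball_step.
  have E := IH (ltnW ij) v vi.
  move: tT; rewrite mem_cat => /orP[tT|/mapP[u uT ut]].
    by rewrite bjT // bkT ?E //; apply: (ball_leq jk).
  have vE : v = v * t * u by rewrite ut mulgVK.
  have := bjT (v * t) u uT vtj; rewrite -vE => /(_ vj) Ej.
  have := bkT (v * t) u uT (ball_leq jk vtj); rewrite -vE => /(_ (ball_leq jk vj)).
  by rewrite -E Ej => /mulIg.
have /choice[l Hl] := generates_ball gT.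
exists (fun h => b (l h) h); apply: is_primitive_gens => //; first by rewrite /s'; lia.
move=> h t tT; pose k := maxn (l h) (l (h * t)).
have hk : l h <= k by rewrite leq_maxl.
have htk : l (h * t) <= k by rewrite leq_maxr.
rewrite (coh _ k _ hk) // (coh _ k _ htk) //.
by apply: (Hb k).2 => //; [apply: ball_leq hk _ | apply: ball_leq htk _].
Qed.

Theorem cqm_subgroup_isog :
  (forall R, exists N M f, coarse_quotient_map S T L P C R N M f) ->
  exists R, forall N M f, coarse_quotient_map S T L P C R N M f ->
    subgroup_isog N M.
Proof.
move=> /cocycles_split_transfer [s' s'0 splitH].
pose A' := (D * s')%N.
(* The summands serve, in order: the lift [F], its multiplicativity [Fmul], [cqm_lift_surj],
   surjectivity onto [M], the lift [G'] of a coarse inverse (with Lipschitz constant [A']), and the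
   equivariance of [d]. *)
pose R := (3 * A + 2 * A + (A * D + 2 * C + 1) + (A * P C + C) + 3 * A' +
  (2 * P C + A' * A + 1))%N.
exists R => N M f cqm.
have nN := cqm_normal_dom cqm; have nM := cqm_normal_cod cqm.
have [|F [fF F1 FA]] := cqm_lift cqm; first by rewrite /R; lia.
have Fgen x g : g \in S -> (F x)^-1 * F (x * g) \in wball T A.
  by move=> gSS; rewrite -[A]muln1; apply: FA; rewrite mulKg; apply: ball_gen.
have FM n : N n -> M (F n).
  move=> Nn; rewrite -[F n]mul1g -[in X in M X]invg1 -(cqm1 cqm).
  rewrite (cqm_mod cqm (y := n)); first exact: fF.
  by rewrite /eqmod invg1 mul1g.
(* As [f] agrees at [n * x] and [x], the increments of [F] along a generator at these two points are
   congruent modulo [M]; both lie in the ball of radius [A], so they are equal. *)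
have Fmul n x : N n -> F (n * x) = F n * F x.
  move=> Nn; move: x; apply: (generates_ind gS) => [|x g gSS].
    by rewrite F1 !mulg1.
  suff E : (F (n * x))^-1 * F (n * (x * g)) = (F x)^-1 * F (x * g).
    have -> : F (n * (x * g)) = F (n * x) * ((F x)^-1 * F (x * g)) by rewrite -E mulVKg.
    split=> [->|]; first by rewrite -mulgA mulVKg.
    by rewrite mulgA => /(canRL (mulgK _)) /(canRL (mulgK _)) ->; rewrite ?gnorm.
  have fN y : f (n * y) = f y.
    apply: (cqm_mod cqm); apply: eqmod_sym => //.
    by rewrite /eqmod mulgA; apply: normalJ.
  apply: (eqmod_ball_eq (cqm_inj_cod cqm) (_ : A + A <= R)).
  - by rewrite /R; lia.
  - by rewrite mulgA; apply: Fgen.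
  - exact: Fgen.
  - apply: (eqmod_trans nM (y := (f x)^-1 * f (x * g))).
      rewrite -(fN x) -(fN (x * g)); apply: eqmod_sym => //.
      by apply: eqmodM => //; apply: eqmodV.
    by apply: eqmodM => //; apply: eqmodV.
exists F; split; last by move=> x y Nx _; apply: Fmul.
split; first by move=> n /FM.
(* Injectivity: [p] is a coarse inverse of [f], Lipschitz modulo [N], and lifts to [G'] because
   cocycles on H split. *)
- have /choice[p Hp] := cqm_surj cqm.
  have [||G' [pG' _ G'A]] := @lift_mod H G T S s' D N p gT s'0 (splitH G) nN.
  + by move=> n Nn nb; apply: (cqm_inj_dom cqm) => //; apply: ball_leq nb; rewrite /R; lia.
  + move=> h t tT; apply: (cqm_lower_gen cqm _ (Hp h) (Hp _)).
    by rewrite mulKg; apply: ball_gen.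
  have /choice[c Hc] x : exists c, c \in wball S (P C) /\ eqmod N (p (F x) * c) x.
    have [|c cC Ec] := (cqm_lower cqm (k := C) (x := p (F x)) (y := x)); last by exists c.
    by apply: near_mod_sym => //; apply: near_mod_eql (Hp _) => //; apply: eqmod_sym.
  (* The short correction [c] makes [d] congruent to the identity modulo [N]. Its increments along
     generators are short, hence are exactly these generators, and [d] is the left translation by
     [d 1]. *)
  pose d x := G' (F x) * c x.
  have dN x : eqmod N (d x) x.
    apply: (eqmod_trans nN _ (Hc x).2); apply: eqmodMr => //.
    exact: eqmod_sym.
  have dS x g : g \in S -> d (x * g) = d x * g.
    move=> gSS; apply: (mulgI (d x)^-1); rewrite mulKg.
    apply: (eqmod_ball_eq (cqm_inj_dom cqm)
      (_ : (P C + A' * A + P C) + 1 <= R) _ (ball_gen gSS)).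
    + by rewrite /R; lia.
    + have -> : (d x)^-1 * d (x * g) =
          (c x)^-1 * ((G' (F x))^-1 * G' (F (x * g))) * c (x * g).
        by rewrite /d invgM !mulgA.
      apply: ballM (Hc _).1; apply: ballM (ballV (Hc _).1) _.
      by apply: G'A; apply: Fgen.
    + have := eqmodM nN (eqmodV nN (dN x)) (dN (x * g)).
      by rewrite mulKg.
  have dE x : d x = d 1 * x.
    move: x; apply: (generates_ind gS) => [|x g gSS]; first by rewrite mulg1.
    by rewrite dS // mulgA; split=> [->|/mulIg].
  move=> n n' /[!inE] Nn Nn' Fnn'.
  (* Elements of [N] are all congruent, so on [N] the correction depends only on the value of
     [F]. *)
  have cc : c n = c n'.
    apply: (eqmod_ball_eq (cqm_inj_dom cqm) (_ : P C + P C <= R) (Hc _).1 (Hc _).1).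
      by rewrite /R; lia.
    have : eqmod N (p (F n) * c n) (p (F n) * c n').
      apply: (eqmod_trans nN (Hc n).2); rewrite Fnn'.
      apply: (eqmod_trans nN _ (eqmod_sym nN (Hc n').2)).
      by apply: subgroupM => //; apply: subgroupV.
    by move/(eqmodMl (p (F n))^-1); rewrite !mulKg.
  by apply: (mulgI (d 1)); rewrite -!dE /d Fnn' cc.
(* Surjectivity: some [F x] is within [C] of [m], which is trivial in H/M, so [x] is within [P C] of
   [N]. After correction to [x * b] in [N], the discrepancy is a short element of [M]. *)
- move=> m Mm.
  have [k mk] := generates_ball gT m.
  have [|x [_ xm]] := cqm_lift_surj cqm _ fF F1 FA mk; first by rewrite /R; lia.
  have [|b bC xb] := cqm_lower cqm (k := C) (x := x) (y := 1).
    rewrite (cqm1 cqm); apply: near_mod_eqr (near_mod_eql _ _ (near_mod_ball _ xm)) => //.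
      by rewrite /eqmod mulg1; apply: subgroupV.
    exact: eqmod_sym.
  have Nxb : N (x * b).
    by have := subgroupV nN xb; rewrite /eqmod mulg1 invgK.
  exists (x * b) => //.
  suff : (F (x * b))^-1 * m = 1 by move/mulg1_eq; rewrite invgK.
  apply: (cqm_inj_cod cqm).
    by apply: subgroupM => //; apply: subgroupV => //; apply: FM.
  rewrite -[m](mulVKg (F x)) mulgA; apply: (@ball_leq _ _ (A * P C + C)).
    by rewrite /R; lia.
  by apply: ballM => //; apply: FA; rewrite invgM mulgVK; apply: ballV.
Qed.

End QuotientMaps.

(** * Box spaces as integer-valued metric spaces *)

Section CosetGraph.
Local Open Scope classical_set_scope.
Local Open Scope group_scope.
Context (G : groupType) (S : seq G) (A : set G).
Hypotheses (gS : generates S) (nA : normal_subgroup A).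

Lemma lcosetP x y : lcoset A x y <-> eqmod A x y.
Proof.
split=> [[a Aa <-]|Axy]; first by rewrite /eqmod mulKg.
exists (x^-1 * y); last by rewrite mulVKg.
exact: Axy.
Qed.

Lemma lcoset_eq x y : lcoset A x = lcoset A y <-> eqmod A x y.
Proof.
split=> [E|xy]; first by apply/lcosetP; rewrite E; apply/lcosetP; exact: (eqmod_refl nA).
apply/seteqP; split=> z /lcosetP xz; apply/lcosetP; last exact: eqmod_trans xz.
by apply: eqmod_trans xz => //; apply: eqmod_sym.
Qed.

Lemma lcoset_mulr x s : [set (y * s)%g | y in lcoset A x] = lcoset A (x * s).
Proof.
apply/seteqP; split=> z.
  by case=> y /lcosetP xy <-; apply/lcosetP; apply: eqmodMr.
move=> /lcosetP xz; exists (z * s^-1); last by rewrite mulgVK.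
by apply/lcosetP; rewrite -[x](mulgK s); apply: eqmodMr.
Qed.

Lemma cayley_adj_lcoset x (C : set G) : cayley_adj S (lcoset A x) C <->
  exists2 e, e \in sym_gens S & C = lcoset A (x * e).
Proof.
split=> [[s [sS [->|E]]]|[e]].
- by exists s; [rewrite mem_cat sS | exact: lcoset_mulr].
- exists s^-1; first by apply: sym_gensV; rewrite mem_cat sS.
  rewrite -lcoset_mulr E; apply/seteqP; split=> z.
    by move=> Cz; exists (z * s); [exists z | rewrite mulgK].
  by case=> _ [y Cy <-] <-; rewrite mulgK.
- rewrite mem_cat => /orP[eS|/mapP[s sS ->]] ->.
    by exists e; split=> //; left; rewrite lcoset_mulr.
  by exists s; split=> //; right; rewrite lcoset_mulr mulgVK.
Qed.

Lemma path_lengths_near k x y :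
  path_lengths S (lcoset A x) (lcoset A y) k -> near_mod S A k x y.
Proof.
case=> p [] + + <-; elim: p x {k} => [|C p IH] x /=.
  by move=> _ /lcoset_eq; apply: near_mod_eqmod.
case/andP => /asboolP/cayley_adj_lcoset[e eS ->] /IH pe /pe.
rewrite -add1n; apply: near_mod_trans => //.
by apply: near_mod_ball => //; rewrite mulKg; apply: ball_sym.
Qed.

Lemma near_path_lengths k x y : near_mod S A k x y ->
  exists2 j, j <= k & path_lengths S (lcoset A x) (lcoset A y) j.
Proof.
case=> b bk /lcoset_eq <- {y}; elim: k b bk => [|k IH] b.
  by rewrite inE => /eqP ->; rewrite mulg1; exists 0 => //; exists [::].
case/ballS=> [/IH[j jk Hj]|[v [e [/IH[j jk [p [pp pl] pj]] eS ->]]]].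
  by exists j => //; apply: leqW.
exists j.+1 => //; exists (rcons p (lcoset A (x * (v * e)))); last first.
  by rewrite size_rcons pj.
rewrite /= last_rcons rcons_path pp; split=> //; apply/asboolP.
by rewrite pl; apply/cayley_adj_lcoset; exists e; rewrite ?mulgA.
Qed.

Lemma finite_index_reps : finite_index A ->
  exists l : seq G, forall x, exists2 y, y \in l & eqmod A y x.
Proof.
move=> /finite_seqP[r Er].
have /choice[g Hg] (C : set G) : exists x, cosets A C -> C = lcoset A x.
  have [[x _ <-]|] := pselect (cosets A C); last by exists 1.
  by exists x.
exists [seq g C | C <- r] => x.
have Cx : cosets A (lcoset A x) by exists x.
exists (g (lcoset A x)); last by apply/lcoset_eq; rewrite -Hg.
by apply: map_f; have : [set` r] (lcoset A x) by rewrite -Er.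
Qed.

Lemma finite_index_near : finite_index A -> exists k, forall x y, near_mod S A k x y.
Proof.
move=> /finite_index_reps[l Hl]; have [k Hk] := seq_ball l gS.
exists (k + k) => x y.
have [u ul ux] := Hl x; have [v vl vy] := Hl y.
apply: (near_mod_eql nA ux); apply: (near_mod_eqr nA vy).
by apply: near_mod_ball => //; apply: ballM; [apply: ballV|]; apply: Hk.
Qed.

Lemma near_mod_total x y : exists k, near_mod S A k x y.
Proof.
by have [k Hk] := generates_ball gS (x^-1 * y); exists k; apply: near_mod_ball.
Qed.

Lemma least_nat (P : nat -> Prop) : (exists k, P k) ->
  (forall j k, j <= k -> P j -> P k) -> exists k, forall j, P j <-> k <= j.
Proof.
move=> [k0 Pk0] Pmono.
have ex : exists k, `[< P k >] by exists k0; apply/asboolP.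
have [k /asboolP Pk kmin] := find_ex_minn ex.
by exists k => j; split=> [Pj|/Pmono/(_ Pk) //]; apply/kmin/asboolP.
Qed.

Context (R : realType).
Local Open Scope ring_scope.

Lemma cayley_dist_nat x y : exists k : nat,
  cayley_dist R S (lcoset A x) (lcoset A y) = k%:R /\
  forall j, near_mod S A j x y <-> (k <= j)%N.
Proof.
have [|k Hk] := least_nat (near_mod_total x y).
  by move=> i j; apply: near_mod_leq.
exists k; split=> //.
have Pk : path_lengths S (lcoset A x) (lcoset A y) k.
  have [j jk Pj] := near_path_lengths ((Hk k).2 (leqnn k)).
  by have /Hk kj := path_lengths_near Pj; have <- : j = k by lia.
apply/eqP; rewrite eq_le; apply/andP; split.
  apply: ge_inf; last by exists k.
  by exists 0 => _ [j _ <-]; rewrite ler0n.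
apply: lb_le_inf; first by exists k%:R; exists k.
by move=> _ [j /path_lengths_near/Hk kj <-]; rewrite ler_nat.
Qed.

Lemma cayley_diam_nat : finite_index A -> exists k : nat,
  cayley_diam R S A = k%:R /\
  forall j, (forall x y, near_mod S A j x y) <-> (k <= j)%N.
Proof.
move=> /finite_index_near ex.
have [|k Hk] := least_nat ex.
  by move=> i j ij H x y; apply: near_mod_leq ij _.
exists k; split=> //.
have near_k := (Hk k).2 (leqnn k).
have dub : ubound [set cayley_dist R S C D | C in cosets A & D in cosets A] k%:R.
  move=> _ [C [x _ <-]] [D [y _ <-]] <-.
  have [j [-> Hj]] := cayley_dist_nat x y.
  by rewrite ler_nat; apply/Hj.
(* A pair realising the diameter: any pair if it is 0, and a pair not within [n] if it is [n.+1]. *)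
have [x [y Hxy]] : exists x y, forall j, near_mod S A j x y -> (k <= j)%N.
  case: (k) Hk => [|n] Hn; first by exists 1%g, 1%g.
  apply: contrapT => /forallNP Hno.
  suff /Hn : forall x y, near_mod S A n x y by rewrite ltnn.
  move=> x y; apply: contrapT => nxy; apply: (Hno x); exists y => j xyj.
  by rewrite ltnNge; apply/negP => jn; apply: nxy; apply: near_mod_leq xyj.
have [j [Ej Hj]] := cayley_dist_nat x y.
have dmem : [set cayley_dist R S C D | C in cosets A & D in cosets A] j%:R.
  by exists (lcoset A x); [exists x | exists (lcoset A y) => //; exists y].
apply/eqP; rewrite eq_le; apply/andP; split.
  by apply: ge_sup => //; exists j%:R.
apply: le_trans (_ : j%:R <= _); first by rewrite ler_nat; apply/Hxy/Hj.
by apply: ub_le_sup => //; exists k%:R.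
Qed.

End CosetGraph.

(** * Integer distances and control functions on box spaces *)

Section BoxSpace.
Local Open Scope classical_set_scope.
Context (G : groupType).

Definition box_point (N : nat -> set G) (i : nat) (x : G) : box_space N :=
  existT _ i (exist _ (lcoset (N i) x) (ex_intro2 _ _ x I erefl)).

Lemma box_pointP (N : nat -> set G) (y : box_space N) :
  exists p : nat * G, y = box_point N p.1 p.2.
Proof.
case: y => i [C HC]; have [x _ E] := HC; subst C; exists (i, x).
by rewrite /box_point /=; congr existT; congr exist; apply: Prop_irrelevance.
Qed.

Lemma box_point_eq (N : nat -> set G) i x y : normal_subgroup (N i) ->
  eqmod (N i) x y -> box_point N i x = box_point N i y.
Proof.
move=> nN /(lcoset_eq nN) E; rewrite /box_point; congr existT.
exact: eq_exist.
Qed.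

(** Distances and the diameters [m i] are specified by their sublevel sets, so that later arguments
    only handle [near_mod]. *)
Definition nat_box_metric (S : seq G) (N : nat -> set G)
    (d : box_space N -> box_space N -> nat) (m : nat -> nat) : Prop :=
  [/\ forall i x y k, d (box_point N i x) (box_point N i y) <= k <->
        near_mod S (N i) k x y,
      forall i j x y, i <> j -> d (box_point N i x) (box_point N j y) = m i + m j &
      forall i k, m i <= k <-> forall x y, near_mod S (N i) k x y].

Lemma box_dist_nat (R : realType) (S : seq G) (N : nat -> set G) :
  generates S -> filtration N -> exists d m, nat_box_metric S d m /\
    forall x y : box_space N, box_dist R S x y = ((d x y)%:R)%R.
Proof.
move=> gS [_ nN fN _].
have /choice[m Hm] i := cayley_diam_nat gS (nN i) R (fN i).
have /choice[d Hd] (p : box_space N * box_space N) : exists k : nat,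
    box_dist R S p.1 p.2 = (k%:R)%R.
  case: p => a b; have [[i x] /= ->] := box_pointP a; have [[j y] /= ->] := box_pointP b.
  rewrite /box_dist /= /box_index /box_coset /=; case: eqP => [<-|_].
    by have [k [Ek _]] := cayley_dist_nat gS (nN i) R x y; exists k.
  by exists (m i + m j); rewrite (Hm i).1 (Hm j).1 natrD.
exists (fun a b => d (a, b)), m; split; last by move=> x y; rewrite (Hd (x, y)).
split=> [i x y k|i j x y ij|i k]; last by rewrite (Hm i).2.
- have [j [Ej ->]] := cayley_dist_nat gS (nN i) R x y.
  suff -> : d (box_point N i x, box_point N i y) = j by [].
  by apply/eqP; rewrite -(eqr_nat R) -Hd -Ej /= /box_dist eqxx.
- apply/eqP; rewrite -(eqr_nat R) -Hd /box_dist /= ifN; last exact/eqP.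
  by rewrite (Hm i).1 (Hm j).1 natrD.
Qed.

(** With integer distances, [up k] only has to bound the finitely many values of [rp] up to [k],
    whether or not [rp] is monotone; [lo k] comes from properness of [rm]. *)
Lemma coarse_equivalence_nat (R : realType) (X Y : Type) (dX : X -> X -> nat)
    (dY : Y -> Y -> nat) :
  coarsely_equivalent (fun x y => ((dX x y)%:R : R)%R) (fun x y => ((dY x y)%:R : R)%R) ->
  exists (phi : X -> Y) (up lo : nat -> nat) (C : nat),
    [/\ forall k a b, dX a b <= k -> dY (phi a) (phi b) <= up k,
        forall k a b, dY (phi a) (phi b) <= k -> dX a b <= lo k &
        forall y, exists x, dY y (phi x) <= C].
Proof.
move=> [phi [[rm [rp [[rm0 pm] _ phiE]]] [C [C0 HC]]]].
have bnd (r : R) : exists n : nat, (r < n%:R)%R.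
  exists (Num.bound `|r|%R); apply: le_lt_trans (ler_norm _) _.
  by apply: archi_boundP; apply: normr_ge0.
have /choice[up Hup] k : exists u, forall j, j <= k -> (rp j%:R < (u%:R : R))%R.
  have /choice[B HB] j := bnd (rp j%:R)%R.
  have [u Hu] := seq_bounded B (iota 0 k.+1).
  exists u => j jk; apply: lt_le_trans (HB j) _.
  by rewrite ler_nat; apply: Hu; rewrite mem_iota.
have /choice[lo Hlo] (k : nat) : exists l : nat, forall j : nat,
    (rm j%:R <= (k%:R : R))%R -> (0 <= rm j%:R)%R -> j <= l.
  have /pm/ex_strict_bound_gt0[M M0 HM] : bounded_set [set r : R | (`|r| <= k%:R)%R].
    rewrite /= /bounded_near; near=> M => r /= /le_trans; apply.
    by near: M; apply: nbhs_pinfty_ge; apply: num_real.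
  have [l Hl] := bnd M; exists l => j jk j0; rewrite -(ler_nat R) ltW //.
  apply: lt_trans Hl; have := HM j%:R%R; rewrite /= normr_nat; apply.
  by split; rewrite ?ler0n // ger0_norm.
have [c Hc] := bnd C.
exists phi, up, lo, c; split.
- move=> k a b ab; have /andP[_ H] := phiE a b.
  by apply: ltnW; rewrite -(ltr_nat R); apply: le_lt_trans H (Hup _ _ ab).
- move=> k a b ab; have /andP[H _] := phiE a b.
  apply: Hlo; last by apply: rm0; rewrite ler0n.
  by apply: le_trans H _; rewrite ler_nat.
- move=> y; have [x Hx] := HC y; exists x.
  by apply: ltnW; rewrite -(ltr_nat R); apply: le_lt_trans Hx Hc.
Unshelve. all: by end_near.
Qed.

End BoxSpace.

(** * Filtrations, indices and displacement *)

Section Filtrations.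
Local Open Scope classical_set_scope.
Local Open Scope group_scope.
Context (G : groupType) (S : seq G) (N : nat -> set G).
Hypotheses (gS : generates S) (fN : filtration N).

Lemma filtration_nested i j : i <= j -> N j `<=` N i.
Proof.
case: fN => nest _ _ _ /subnK <-; elim: (j - i) => [|n IH] //.
by apply: subset_trans IH; apply: nest.
Qed.

Lemma filtration_avoid (F : seq G) : 1 \notin F ->
  exists i0, forall i x, i0 <= i -> x \in F -> ~ N i x.
Proof.
move=> F1; have /choice[a Ha] x : exists i, x \in F -> ~ N i x.
  have [xF|] := boolP (x \in F); last by exists 0.
  have [_ _ _ NI] := fN; apply: contrapT => /forallNP Nx.
  have : (\bigcap_i N i) x by move=> i _; apply: contrapT => nN; apply: (Nx i).
  by rewrite NI /= => x1; move: F1; rewrite -x1 xF.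
have [i0 Hi0] := seq_bounded a F.
exists i0 => i x ii0 xF Nx; apply: (Ha x xF).
by apply: filtration_nested Nx; apply: leq_trans ii0; apply: Hi0.
Qed.

Lemma filtration_inj_radius R :
  exists i0, forall i x, i0 <= i -> N i x -> x \in wball S R -> x = 1.
Proof.
have [|i0 Hi0] := @filtration_avoid [seq x <- wball S R | x != 1].
  by rewrite mem_filter eqxx.
exists i0 => i x ii0 Nx xR; apply/eqP; apply: contrapT => /negP x1.
by apply: (Hi0 i x ii0) => //; rewrite mem_filter x1.
Qed.

(** For a generating [S] this is finiteness of G, balls being finite. *)
Definition bounded_group := exists R, forall x, x \in wball S R.

(** Take [x] outside the ball of radius [k]. High levels avoid the finitely many elements [b^-1 * x]
    with [b] in that ball, so the coset of [x] is farther than [k] from that of 1. *)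
Lemma filtration_diam_infty (d : box_space N -> box_space N -> nat) m :
  nat_box_metric S d m -> ~ bounded_group ->
  forall k, exists i0, forall i, i0 <= i -> k < m i.
Proof.
move=> [_ _ dm] nb k.
have [x xk] : exists x, x \notin wball S k.
  apply: contrapT => /forallNP H; apply: nb; exists k => x.
  by apply: contrapT => /negP; apply: H.
have [|i0 Hi0] := @filtration_avoid [seq b^-1 * x | b <- wball S k].
  apply/mapP => -[b bk /esym/mulg1_eq]; rewrite invgK => bx.
  by move: xk; rewrite -bx bk.
exists i0 => i ii0; rewrite ltnNge; apply/negP => /dm/(_ 1 x)[b bk].
rewrite mul1g => Nbx; apply: (Hi0 i (b^-1 * x)) => //.
by apply: map_f.
Qed.

Lemma filtration_bounded_trivial : bounded_group ->
  exists i0, forall i, i0 <= i -> N i = [set 1].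
Proof.
move=> [R HR]; have [i0 Hi0] := filtration_inj_radius R.
exists i0 => i ii0; apply/seteqP; split=> x.
  by move=> Nx; apply: (Hi0 i).
by move=> ->; have [_ /(_ i) [[]]] := fN.
Qed.

(** A trivial [N i] of finite index would bound the group, so the exception in [properly_nested]
    does not occur for an infinite group. *)
Lemma proper_filtration_strict : properly_nested N -> ~ bounded_group ->
  forall i, exists2 z, N i z & ~ N i.+1 z.
Proof.
move=> pN nb i; apply: contrapT => H; apply: nb.
have Ni : N i = [set 1].
  apply: pN; apply/seteqP; split; first by apply: filtration_nested.
  by move=> z Nz; apply: contrapT => nNz; apply: H; exists z.
have [_ /(_ i) nN /(_ i) fiN _] := fN.
have [k Hk] := finite_index_near gS nN fiN.
exists k => x; have [b bk] := Hk 1 x.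
by rewrite /eqmod Ni mul1g => /mulg1_eq; rewrite invgK => <-.
Qed.

End Filtrations.

(** * Comparison of indices by packing and covering *)

Section Counting.
Local Open Scope classical_set_scope.
Local Open Scope group_scope.

(** Such lists bound the index of [A] from below, as those of [covers] do from above; together they
    replace the index itself. *)
Definition packs (G : groupType) (A : set G) (l : seq G) :=
  uniq l /\ forall x y, x \in l -> y \in l -> eqmod A x y -> x = y.

Definition covers (G : groupType) (A : set G) (l : seq G) :=
  forall x, exists2 y, y \in l & eqmod A y x.

Lemma packs_covers (G : groupType) (A : set G) l l' : normal_subgroup A ->
  packs A l -> covers A l' -> size l <= size l'.
Proof.
move=> nA [ul pl] cl'.
have /choice[g Hg] x : exists y, y \in l' /\ eqmod A y x by have [y] := cl' x; exists y.
rewrite -(size_map g); apply: uniq_leq_size.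
  rewrite map_inj_in_uniq // => x y xl yl gxy; apply: pl => //.
  apply: (eqmod_trans nA (eqmod_sym nA (Hg x).2)); rewrite gxy.
  exact: (Hg y).2.
by move=> _ /mapP[x _ ->]; apply: (Hg x).1.
Qed.

Lemma covers_packs (G : groupType) (A : set G) l : normal_subgroup A ->
  covers A l -> exists l', packs A l' /\ covers A l'.
Proof.
move=> nA cl.
suff [l' [pl' Hl']] : exists l', packs A l' /\
    forall x, x \in l -> exists2 y, y \in l' & eqmod A y x.
  exists l'; split=> // x; have [y /Hl'[z zl' zy] yx] := cl x.
  by exists z => //; apply: eqmod_trans yx.
elim: l {cl} => [|x l [l' [[ul' pl'] Hl']]]; first by exists [::].
have [[y yl' yx]|nx] := pselect (exists2 y, y \in l' & eqmod A y x).
  exists l'; split=> // z; rewrite inE => /orP[/eqP ->|/Hl' //].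
  by exists y.
exists (x :: l'); split.
  split=> [|y z].
    rewrite /= ul' andbT; apply/negP => xl'; apply: nx; exists x => //.
    exact: (eqmod_refl nA).
  rewrite !inE => /orP[/eqP ->|yl'] /orP[/eqP ->|zl'] // yz.
  - by case: nx; exists z => //; apply: eqmod_sym.
  - by case: nx; exists y.
  - exact: pl'.
move=> z; rewrite inE => /orP[/eqP ->|/Hl'[y yl' yz]].
  by exists x; rewrite ?mem_head //; apply: eqmod_refl.
by exists y; rewrite // inE yl' orbT.
Qed.

(** The coset of [x] modulo [A] contains the two distinct cosets of [x] and [x * z] modulo [B]. *)
Lemma packs_double (G : groupType) (A B : set G) z l :
  normal_subgroup A -> normal_subgroup B -> B `<=` A -> A z -> ~ B z ->
  packs A l -> packs B (l ++ [seq x * z | x <- l]).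
Proof.
move=> nA nB BA Az nBz [ul pl].
have Axz x : eqmod A x (x * z) by rewrite /eqmod mulKg.
have nxz x y : x \in l -> y \in l -> ~ eqmod B x (y * z).
  move=> xl yl xyz; have xy : x = y.
    apply: pl => //; apply: (eqmod_trans nA (BA _ xyz)).
    by apply: eqmod_sym.
  by move: xyz; rewrite xy /eqmod mulKg.
split.
  rewrite cat_uniq ul /= map_inj_uniq ?ul ?andbT; last exact: mulIg.
  apply/hasPn => _ /mapP[y yl ->]; apply/negP => yzl.
  by apply: (nxz (y * z) y) => //; apply: eqmod_refl.
move=> x y; rewrite !mem_cat.
move=> /orP[xl|/mapP[x' xl ->]] /orP[yl|/mapP[y' yl ->]] xy.
- by apply: pl => //; apply: BA.
- by case: (nxz x y').
- by case: (nxz y x') => //; apply: eqmod_sym.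
- congr (_ * _); apply: pl => //; apply: (eqmod_trans nA (Axz x')).
  by apply: (eqmod_trans nA (BA _ xy)); apply: eqmod_sym.
Qed.

Lemma packs_filtration (G : groupType) (N : nat -> set G) i l K :
  filtration N -> (forall i, exists2 z, N i z & ~ N i.+1 z) ->
  packs (N i) l -> exists2 l', packs (N (i + K)) l' & size l' = (2 ^ K * size l)%N.
Proof.
move=> fN sN pl; have [nest nN _ _] := fN.
elim: K => [|K [l' pl' sl']]; first by exists l; rewrite ?addn0 ?mul1n.
have [z Nz nNz] := sN (i + K)%N.
exists (l' ++ [seq x * z | x <- l']).
  by rewrite addnS; apply: packs_double pl'.
by rewrite size_cat size_map sl' expnS; lia.
Qed.

(** The image of a cover of G/N, thickened by [C], covers H/M and hence H/M'. Pulling it back along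
    [f'], whose fibres have diameter at most [P 0], covers G/N'. *)
Lemma cqm_index_bound (G H : groupType) (S : seq G) (T : seq H) L P C
    R N M f R' N' M' f' l l' :
  coarse_quotient_map S T L P C R N M f ->
  coarse_quotient_map S T L P C R' N' M' f' -> M `<=` M' ->
  covers N l -> packs N' l' ->
  size l' <= size l * (size (wball T C) * size (wball S (P 0))).
Proof.
move=> cqm cqm' MM' cl pl'.
have nM' := cqm_normal_cod cqm'; have nM := cqm_normal_cod cqm.
pose l1 := [seq f x * b | x <- l, b <- wball T C].
have cl1 : covers M' l1.
  move=> h; have [x /(near_mod_sym nM)[b bC xb]] := cqm_surj cqm h.
  have [y yl /(cqm_mod cqm) fyx] := cl x.
  exists (f y * b); first by apply/allpairsP; exists (y, b).
  by apply: MM'; rewrite fyx.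
have /choice[g Hg] h : exists x, (exists y, eqmod M' (f' y) h) -> eqmod M' (f' x) h.
  by have [[y yh]|] := pselect (exists y, eqmod M' (f' y) h); [exists y | exists 1].
pose l2 := [seq g h * b | h <- l1, b <- wball S (P 0)].
have cl2 : covers N' l2.
  move=> x; have [h hl1 hx] := cl1 (f' x).
  have ghx : eqmod M' (f' (g h)) (f' x).
    apply: (eqmod_trans nM' _ hx); apply: Hg; exists x.
    exact: (eqmod_sym nM' hx).
  have [b bP gbx] := cqm_lower cqm' (near_mod_eqmod T 0 ghx).
  by exists (g h * b) => //; apply/allpairsP; exists (h, b).
apply: leq_trans (packs_covers (cqm_normal_dom cqm') pl' cl2) _.
by rewrite !size_allpairs mulnA.
Qed.

End Counting.

Section AlmostPermutations.
Local Open Scope classical_set_scope.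

(** Two pigeonhole counts. Indices from [i1] to below [i - K] inject into values below [c i]; values
    from [j0] to below [c i] come from indices below [i + K]. *)
Lemma bounded_displacement_almost_permutation (c : nat -> nat) i1 j0 K :
  (forall i i', i1 <= i -> i1 <= i' -> c i = c i' -> i = i') ->
  (forall j, j0 <= j -> exists2 i, i1 <= i & c i = j) ->
  (forall i i', i1 <= i -> i + K <= i' -> c i < c i') ->
  almost_permutation [set i | i1 <= i] (c @` [set i | i1 <= i]) c /\
  bounded_displacement [set i | i1 <= i] c.
Proof.
move=> cinj csurj cinc; split.
  split.
  - apply: (sub_finite_set _ (finite_II i1)) => i /= /negP.
    by rewrite -ltnNge.
  - apply: (sub_finite_set _ (finite_II j0)) => j /= nj.
    rewrite ltnNge; apply/negP => /csurj[i ii1 ij].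
    by apply: nj; exists i.
  - split.
    + by move=> i Di; exists i.
    + by move=> i i' /[!inE] /= Di Di' E; apply: cinj.
    + by move=> _ [i Di <-]; exists i.
exists (K + i1 + j0), 0 => i /= ii1 _.
have lo : i <= c i + (K + i1).
  suff : size (map c (iota i1 (i - (K + i1)))) <= size (iota 0 (c i)).
    by rewrite size_map !size_iota; lia.
  apply: uniq_leq_size.
    rewrite map_inj_in_uniq ?iota_uniq // => a b; rewrite !mem_iota => Ha Hb E.
    by apply: cinj => //; lia.
  move=> _ /mapP[a + ->]; rewrite !mem_iota => Ha.
  by apply: cinc; lia.
have hi : c i <= i + K + j0.
  have /choice[e He] j : exists a, j0 <= j -> i1 <= a /\ c a = j.
    have [jj0|_] := leqP j0 j; last by exists 0.
    by have [a] := csurj j jj0; exists a.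
  suff : size (map e (iota j0 (c i - j0))) <= size (iota 0 (i + K)).
    by rewrite size_map !size_iota; lia.
  apply: uniq_leq_size.
    rewrite map_inj_in_uniq ?iota_uniq // => a b; rewrite !mem_iota => Ha Hb E.
    have [|_ <-] := He a; first by lia.
    by have [|_ <-] := He b; [lia | rewrite E].
  move=> _ /mapP[j + ->]; rewrite !mem_iota => Hj.
  have [|ej cj] := He j; first by lia.
  rewrite /= add0n ltnNge; apply/negP => /(cinc i (e j) ii1).
  by rewrite cj; lia.
by lia.
Qed.

End AlmostPermutations.

(** * Components of coarsely equivalent box spaces *)

Section NatBoxMetric.
Local Open Scope classical_set_scope.
Local Open Scope group_scope.
Context (G : groupType) (S : seq G) (N : nat -> set G).
Context (d : box_space N -> box_space N -> nat) (m : nat -> nat).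
Hypothesis dm : nat_box_metric S d m.
Hypothesis nN : forall i, normal_subgroup (N i).

Lemma box_metric_near i x y k :
  d (box_point N i x) (box_point N i y) <= k <-> near_mod S (N i) k x y.
Proof. by case: dm. Qed.

Lemma box_metric_ne a b : box_index a != box_index b ->
  d a b = m (box_index a) + m (box_index b).
Proof.
have [[i x] /= ->] := box_pointP a; have [[j y] /= ->] := box_pointP b.
by move/eqP; case: dm => _ + _; apply.
Qed.

Lemma box_metric_index k a b : d a b <= k -> k < m (box_index a) + m (box_index b) ->
  box_index a = box_index b.
Proof.
by move=> dk km; have [//|/box_metric_ne E] := eqVneq (box_index a) (box_index b); lia.
Qed.

Lemma box_metric_refl a : d a a = 0.
Proof.
have [[i x] /= ->] := box_pointP a; apply/eqP; rewrite -leqn0.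
by apply/box_metric_near/near_mod_refl.
Qed.

Lemma box_metric_diam a b : d a b <= m (box_index a) + m (box_index b).
Proof.
have [E|/box_metric_ne ->//] := eqVneq (box_index a) (box_index b).
move: E; have [[i x] /= ->] := box_pointP a; have [[j y] /= ->] := box_pointP b.
rewrite /box_index /= => <-; apply/box_metric_near.
apply: near_mod_leq (leq_addr _ _) _.
by case: dm => _ _ H; apply: (H i (m i)).1.
Qed.

Lemma box_point_of i (a : box_space N) : box_index a = i -> exists x, a = box_point N i x.
Proof. by have [[j x] /= ->] := box_pointP a; rewrite /box_index /= => <-; exists x. Qed.

Lemma box_metric_trans i j k a b c : box_index a = i -> box_index b = i -> box_index c = i ->
  d a b <= j -> d b c <= k -> d a c <= j + k.
Proof.
move=> /box_point_of[x ->] /box_point_of[y ->] /box_point_of[z ->].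
by rewrite !box_metric_near; apply: near_mod_trans.
Qed.

Lemma box_metric_sym i k a b : box_index a = i -> box_index b = i ->
  d a b <= k -> d b a <= k.
Proof.
move=> /box_point_of[x ->] /box_point_of[y ->].
by rewrite !box_metric_near; apply: near_mod_sym.
Qed.

End NatBoxMetric.

Lemma near_modMl (G : groupType) (S : seq G) (A : set G) k (z x y : G) :
  near_mod S A k x y -> near_mod S A k (z * x)%g (z * y)%g.
Proof. by case=> b bk xy; exists b; rewrite -?mulgA //; apply: eqmodMl. Qed.

Lemma prefix_bounded (f : nat -> nat) k : exists u, forall i, i < k -> f i <= u.
Proof.
have [u Hu] := seq_bounded f (iota 0 k).
by exists u => i ik; apply: Hu; rewrite mem_iota.
Qed.

(** * The map on components induced by a coarse equivalence *)

Section Components.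
Local Open Scope classical_set_scope.
Local Open Scope group_scope.
Context (G H : groupType) (S : seq G) (T : seq H).
Context (N : nat -> set G) (M : nat -> set H).
Context (dG : box_space N -> box_space N -> nat) (mG : nat -> nat).
Context (dH : box_space M -> box_space M -> nat) (mH : nat -> nat).
Context (phi : box_space N -> box_space M) (up lo : nat -> nat) (C : nat).
Hypotheses (gS : generates S) (gT : generates T).
Hypotheses (fN : filtration N) (fM : filtration M).
Hypotheses (dmG : nat_box_metric S dG mG) (dmH : nat_box_metric T dH mH).
Hypothesis phi_up : forall k a b, dG a b <= k -> dH (phi a) (phi b) <= up k.
Hypothesis phi_lo : forall k a b, dH (phi a) (phi b) <= k -> dG a b <= lo k.
Hypothesis phi_surj : forall y, exists a, dH y (phi a) <= C.

Let nN i : normal_subgroup (N i). Proof. by case: fN. Qed.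
Let nM i : normal_subgroup (M i). Proof. by case: fM. Qed.

(** For finite G the box space has bounded diameter, so all images are close together; but for
    infinite H the components [j0] and [j0.+1] are both reached and far apart. *)
Lemma bounded_group_image : bounded_group S -> bounded_group T.
Proof.
move=> [R HR]; apply: contrapT => nb.
have mGR i : mG i <= R.
  by case: dmG => _ _ HmG; apply/HmG => x y; apply: near_mod_ball.
have [j0 Hj0] := filtration_diam_infty fM dmH nb (up (R + R) + C).
have ex j : j0 <= j -> exists a, box_index (phi a) = j.
  move=> jj0; have [a Ha] := phi_surj (box_point M j 1); exists a.
  symmetry; apply: (box_metric_index dmH Ha).
  by have := Hj0 j jj0; rewrite {2}/box_index /=; lia.
have [a Ea] := ex j0 (leqnn _); have [b Eb] := ex j0.+1 (leqnSn _).
have /phi_up D1 : dG a b <= R + R.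
  by apply: leq_trans (box_metric_diam dmG a b) _; apply: leq_add.
have := box_metric_index dmH D1; rewrite Ea Eb => E.
suff : j0 = j0.+1 by lia.
by apply: E; have := Hj0 j0 (leqnn _); lia.
Qed.

Lemma bounded_group_preimage : bounded_group T -> bounded_group S.
Proof.
move=> [R HR]; apply: contrapT => nb.
have mHR i : mH i <= R.
  by case: dmH => _ _ HmH; apply/HmH => x y; apply: near_mod_ball.
have [i0 Hi0] := filtration_diam_infty fN dmG nb (lo (R + R)).
have /phi_lo D1 : dH (phi (box_point N i0 1)) (phi (box_point N i0.+1 1)) <= R + R.
  by apply: leq_trans (box_metric_diam dmH _ _) _; apply: leq_add.
suff : i0 = i0.+1 by lia.
apply: (box_metric_index dmG D1); rewrite /box_index /=.
by have := Hi0 i0 (leqnn _); lia.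
Qed.

Hypothesis nbG : ~ bounded_group S.

Let nbH : ~ bounded_group T.
Proof. by move/bounded_group_preimage. Qed.

(** Points sent below [j0] have images at bounded distance from one another, hence are themselves at
    bounded distance; a component of large diameter is too far from any other one. *)
Lemma box_map_proper j0 : exists i0, forall a, i0 <= box_index a -> j0 <= box_index (phi a).
Proof.
have [[a aj0]|na] := pselect (exists a, box_index (phi a) < j0); last first.
  by exists 0 => a _; rewrite leqNgt; apply/negP => aj0; apply: na; exists a.
have [u Hu] := prefix_bounded mH j0.
have [i1 Hi1] := filtration_diam_infty fN dmG nbG (lo (u + u)).
exists (maxn i1 (box_index a).+1) => b Hb; rewrite leqNgt; apply/negP => bj0.
have /phi_lo D1 : dH (phi a) (phi b) <= u + u.
  by apply: leq_trans (box_metric_diam dmH _ _) _; apply: leq_add; apply: Hu.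
have := box_metric_index dmG D1.
have := Hi1 (box_index b); lia.
Qed.

Definition component_map i := box_index (phi (box_point N i 1)).
Local Notation c := component_map.

(** Both parts propagate along generators. Neighbours in G/N_i have images within [up 1], too close
    to change component; approximate preimages of neighbours in H/M_(c i) are within
    [lo (C + 1 + C)], too close to leave component [i], and the start is the image of the base
    point. *)
Lemma box_map_components : exists i1, forall i, i1 <= i ->
  (forall a, box_index a = i -> box_index (phi a) = c i) /\
  (forall y a, box_index y = c i -> dH y (phi a) <= C -> box_index a = i).
Proof.
have [j0 Hj0] := filtration_diam_infty fM dmH nbH (up 1 + C).
have [i0 Hi0] := box_map_proper j0.
have [i1 Hi1] := filtration_diam_infty fN dmG nbG (lo (C + 1 + C) + lo C).
exists (maxn i0 i1) => i ii1.
have ci : up 1 + C < mH (c i) by apply: Hj0; apply: Hi0; rewrite /box_index /=; lia.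
have mi : lo (C + 1 + C) + lo C < mG i by apply: Hi1; lia.
split.
  move=> a /box_point_of[x ->]; move: x; apply: (generates_ind gS) => // x s sS.
  suff -> : box_index (phi (box_point N i x)) = box_index (phi (box_point N i (x * s))).
    by [].
  have /phi_up D1 : dG (box_point N i x) (box_point N i (x * s)) <= 1.
    apply/(box_metric_near dmG); apply: near_mod_ball => //.
    by rewrite mulKg; apply: ball_gen.
  apply: (box_metric_index dmH D1).
  suff : up 1 < mH (box_index (phi (box_point N i x))) by lia.
  apply: leq_ltn_trans (Hj0 _ (Hi0 _ _)); first by lia.
  by rewrite /box_index /=; lia.
have near_c y a : box_index y = c i -> dH y (phi a) <= C -> box_index (phi a) = c i.
  move=> yi ya; rewrite -yi; symmetry; apply: (box_metric_index dmH ya).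
  by rewrite yi; lia.
have [h0 Eh0] : exists h0, phi (box_point N i 1) = box_point M (c i) h0.
  exact: box_point_of.
suff main : forall h a, dH (box_point M (c i) (h0 * h)) (phi a) <= C -> box_index a = i.
  by move=> y a /box_point_of[h ->]; rewrite -[h](mulVKg h0); apply: main.
have step h h' : h^-1 * h' \in wball T 1 ->
    (forall a, dH (box_point M (c i) h) (phi a) <= C -> box_index a = i) ->
    forall a, dH (box_point M (c i) h') (phi a) <= C -> box_index a = i.
  move=> hh' IH a' Ha'; have [a Ha] := phi_surj (box_point M (c i) h).
  pose y := box_point M (c i) h; pose y' := box_point M (c i) h'.
  have yc : box_index y = c i by [].
  have yc' : box_index y' = c i by [].
  have ca := near_c _ _ yc Ha; have ca' := near_c _ _ yc' Ha'.
  have yy' : dH y y' <= 1.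
    by apply/(box_metric_near dmH); apply: near_mod_ball.
  have := box_metric_sym dmH nM yc ca Ha => ay.
  have := box_metric_trans dmH nM ca yc yc' ay yy' => ay'.
  have := box_metric_trans dmH nM ca yc' ca' ay' Ha'.
  move/phi_lo => D1; rewrite -(IH a Ha); symmetry; apply: (box_metric_index dmG D1).
  by rewrite (IH a Ha); lia.
apply: (generates_ind gT) => [a|h t tT].
  rewrite mulg1 -Eh0 => /phi_lo D1; symmetry.
  by apply: (box_metric_index dmG D1); rewrite {1}/box_index /=; lia.
have ht : (h0 * h)^-1 * (h0 * (h * t)) \in wball T 1.
  by rewrite [h0 * (h * t)]mulgA mulKg; apply: ball_gen.
by split; apply: step => //; have := ballV ht; rewrite invgM invgK.
Qed.

Lemma component_map_infty j0 : exists i0, forall i, i0 <= i -> j0 <= c i.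
Proof. by have [i0 Hi0] := box_map_proper j0; exists i0 => i ii0; apply: Hi0. Qed.

(** An approximate preimage below [i1] would be at bounded distance from [o], and its image would be
    too close to [phi o] to lie in another, large component [j]. *)
Lemma component_map_cofinite i1 : exists j0, forall j, j0 <= j ->
  exists2 a, i1 <= box_index a & box_index (phi a) = j.
Proof.
have [u Hu] := prefix_bounded mG i1.
have [j1 Hj1] := filtration_diam_infty fM dmH nbH (up (mG 0 + u) + C).
pose o := box_point N 0 1.
exists (maxn j1 (box_index (phi o)).+1) => j Hj.
have mj : up (mG 0 + u) + C < mH j by apply: Hj1; lia.
have [a Ha] := phi_surj (box_point M j 1).
have aj : box_index (phi a) = j.
  by symmetry; apply: (box_metric_index dmH Ha); rewrite {1}/box_index /=; lia.
exists a => //; rewrite leqNgt; apply/negP => ai1.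
have /phi_up D1 : dG o a <= mG 0 + u.
  by apply: leq_trans (box_metric_diam dmG _ _) _; rewrite leq_add2l; apply: Hu.
by have := box_metric_index dmH D1; rewrite aj; lia.
Qed.

Lemma component_quotient_maps : exists i1, forall R, exists i0, forall i,
  i1 <= i -> i0 <= i ->
  exists f, coarse_quotient_map S T (up 1) lo C R (N i) (M (c i)) f.
Proof.
have [i1 Hi1] := box_map_components; exists i1 => R.
have [i2 Hi2] := filtration_inj_radius S fN R.
have [j3 Hj3] := filtration_inj_radius T fM R.
have [i3 Hi3] := component_map_infty j3.
exists (maxn i2 i3) => i ii1 ii0; have [phic near_c] := Hi1 i ii1.
have /choice[r Hr] y : exists h, box_index y = c i -> y = box_point M (c i) h.
  have [yc|yc] := pselect (box_index y = c i); last by exists 1.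
  by have [h ->] := box_point_of yc; exists h.
pose rep x := r (phi (box_point N i x)).
have repE x : phi (box_point N i x) = box_point M (c i) (rep x).
  by apply: Hr; apply: phic.
(* Left translation is an isometry of H/M_(c i), so [f 1 = 1] can be arranged. *)
pose f x := (rep 1)^-1 * rep x.
have repf x : rep x = rep 1 * f x by rewrite /f mulVKg.
exists f; split.
- exact: nN.
- exact: nM.
- by move=> n Nn; apply: (Hi2 i) => //; lia.
- by move=> m Mm; apply: (Hj3 (c i)) => //; apply: Hi3; lia.
- exact: mulVg.
- by move=> x y xy; rewrite /f /rep (box_point_eq (nN i) xy).
- move=> x g gSS; apply: near_modMl; apply/(box_metric_near dmH).
  rewrite -!repE; apply: phi_up; apply/(box_metric_near dmG).
  by apply: near_mod_ball => //; rewrite mulKg; apply: ball_gen.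
- move=> k x y /(near_modMl (rep 1)); rewrite -!repf => /(box_metric_near dmH).
  by rewrite -!repE => /phi_lo/(box_metric_near dmG).
- move=> h; have [a Ha] := phi_surj (box_point M (c i) (rep 1 * h)).
  have yc : box_index (box_point M (c i) (rep 1 * h)) = c i by [].
  have [x Ea] := box_point_of (near_c _ _ yc Ha); exists x.
  rewrite -[h](mulKg (rep 1)); apply: near_modMl.
  by apply/(box_metric_near dmH); rewrite -repE -Ea.
Qed.

End Components.

(** * Assembly of the almost permutation *)

Lemma subgroup_isog_trivial (G H : groupType) :
  subgroup_isog ([set 1%g] : set G)%classic ([set 1%g] : set H)%classic.
Proof.
exists (fun _ => 1%g); split; last by move=> x y _ _; rewrite mulg1.
split; first by move=> x.
- by move=> x y /[!inE] /= -> ->.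
- by move=> _ /= ->; exists 1%g.
Qed.

Theorem theorem1p5 (R : realType) (G H : groupType) (S : seq G) (T : seq H)
    (N : nat -> set G) (M : nat -> set H)
    (G_fp : finitely_presented G)
    (S_gen : generates S) (T_gen : generates T)
    (N_filtration : filtration N) (M_filtration : filtration M)
    (N_proper : properly_nested N)
    (boxes_equiv : coarsely_equivalent
       (@box_dist R G S N) (@box_dist R H T M)) :
  exists (D E : set nat) (f : nat -> nat),
    [/\ almost_permutation D E f,
        bounded_displacement D f &
        forall i : nat, D i -> subgroup_isog (N i) (M (f i))].
Proof.
have [dG [mG [dmG EG]]] := box_dist_nat R S_gen N_filtration.
have [dH [mH [dmH EH]]] := box_dist_nat R T_gen M_filtration.
move: boxes_equiv.
have -> : @box_dist R G S N = fun a b => ((dG a b)%:R)%R.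
  by apply/funext => a; apply/funext => b.
have -> : @box_dist R H T M = fun a b => ((dH a b)%:R)%R.
  by apply/funext => a; apply/funext => b.
move=> /coarse_equivalence_nat[phi [up [lo [C [phi_up phi_lo phi_surj]]]]].
(* If G is finite then so is H, both filtrations are eventually trivial, and the identity on a tail
   works. *)
have [bG|nbG] := pselect (bounded_group S).
  have bH := bounded_group_image N_filtration M_filtration dmG dmH phi_up phi_surj bG.
  have [i0 Hi0] := filtration_bounded_trivial N_filtration bG.
  have [j0 Hj0] := filtration_bounded_trivial M_filtration bH.
  pose n := maxn i0 j0.
  have [||| ap bd] := @bounded_displacement_almost_permutation id n n 1.
  - by [].
  - by move=> j nj; exists j.
  - by move=> i i' _; rewrite addn1.
  exists [set i | n <= i]%classic, (id @` [set i | n <= i])%classic, id.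
  split=> // i /= ni.
  rewrite Hi0 ?Hj0; first exact: subgroup_isog_trivial.
  - by apply: leq_trans ni; rewrite leq_maxr.
  - by apply: leq_trans ni; rewrite leq_maxl.
have [i1 Hi1] := box_map_components S_gen T_gen N_filtration M_filtration
  dmG dmH phi_up phi_lo phi_surj nbG.
have [i2 Hi2] := component_quotient_maps S_gen T_gen N_filtration M_filtration
  dmG dmH phi_up phi_lo phi_surj nbG.
have [s s0 split_s] := cocycles_split_finitely_presented G_fp S_gen.
have [Q|Q HQ] := cqm_subgroup_isog (L := up 1) (P := lo) (C := C) S_gen T_gen s0 split_s.
  have [i0 Hi0] := Hi2 Q.
  have [f Hf] := Hi0 (maxn i2 i0) (leq_maxl _ _) (leq_maxr _ _).
  by exists (N (maxn i2 i0)), (M (component_map phi (maxn i2 i0))), f.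
have [i3 Hi3] := Hi2 Q.
pose n := maxn i1 (maxn i2 i3); pose c := component_map phi.
have n1 i : n <= i -> i1 <= i by rewrite /n; lia.
have cqm i : n <= i -> exists f, coarse_quotient_map S T (up 1) lo C Q (N i) (M (c i)) f.
  by move=> ni; apply: Hi3; move: ni; rewrite /n; lia.
have [_ nN fiN _] := N_filtration.
have [j0 Hj0] := component_map_cofinite N_filtration M_filtration dmG dmH phi_up phi_lo
  phi_surj nbG n.
pose B := size (wball T C) * size (wball S (lo 0)).
have [||| ap bd] := @bounded_displacement_almost_permutation c n j0 B.
(* The image of the base point of component [i'] lies in component [c i] and is at distance 0 from
   itself, so [i'] is the component of its approximate preimages, namely [i]. *)
- move=> i i' ni ni' cc; symmetry.
  apply: ((Hi1 i (n1 _ ni)).2 (phi (box_point N i' 1%g)) (box_point N i' 1%g)).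
    exact: (esym cc).
  by rewrite (box_metric_refl dmH) //; case: M_filtration.
- move=> j /Hj0[a na aj]; exists (box_index a) => //.
  by rewrite -aj; symmetry; apply: (Hi1 _ (n1 _ na)).1.
(* If [c i' <= c i], nestedness makes the index of [N i'] at most [B] times that of [N i], whereas
   at least [B] doublings give a factor of at least [2 ^ B > B]. *)
- move=> i i' ni ii'; rewrite ltnNge; apply/negP => cc.
  have [f Hf] := cqm i ni.
  have [|f' Hf'] := cqm i'; first by lia.
  have [l0 /(covers_packs (nN i))[l [pl cl]]] := finite_index_reps (nN i) (fiN i).
  have sN := proper_filtration_strict S_gen N_filtration N_proper nbG.
  have [l' pl' sl'] := packs_filtration (i' - i) N_filtration sN pl.
  have MM : (M (c i) `<=` M (c i'))%classic by apply: filtration_nested.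
  rewrite subnKC in pl'; last by lia.
  have := cqm_index_bound Hf Hf' MM cl pl'.
  have l_gt0 : 0 < size l by have [y] := cl 1%g; case: (l).
  rewrite sl' mulnC leq_pmul2l // -/B leqNgt => /negP; apply.
  by apply: leq_ltn_trans (ltn_expl _ (ltnSn 1)); lia.
exists [set i | n <= i]%classic, (c @` [set i | n <= i])%classic, c.
by split=> // i /cqm[f /HQ].
Qed.
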